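(* Let $n\ge1$. Let $A$ be a strongly $(n,d_1)$-representation-directed algebra and $B$ a strongly $(n,d_2)$-representation-directed algebra. Let $P$ be a simple projective $A$-module and $I$ a simple injective $B$-module. Then the gluing $\Lambda$ of $A$ and $B$ along $P$ and $I$ is a strongly $(n,d)$-representation-directed algebra for some $d$ with $\max\{d_1,d_2\}\le d\le d_1+d_2$.
   Context: $K$ is an algebraically closed field; algebras are basic finite-dimensional unital associative $K$-algebras; modules are finite-dimensional right modules. An algebra is representation-directed if there is no sequence of nonzero nonisomorphisms $M_0\to M_1\to\cdots\to M_t$ ($t\ge1$) between indecomposable modules with $M_0\cong M_t$. A full subcategory $\mathcal{C}\subseteq\operatorname{mod}\Lambda$ closed under isomorphisms, direct sums and summands is $n$-cluster tilting if $\mathcal{C}=\{X\mid\operatorname{Ext}^i_\Lambda(\mathcal{C},X)=0,\ 0<i<n\}=\{X\mid\operatorname{Ext}^i_\Lambda(X,\mathcal{C})=0,\ 0<i<n\}$. An algebra $\Lambda$ is strongly $(n,d)$-representation-directed if it is representation-directed, has global dimension $d$, and $\operatorname{mod}\Lambda$ admits an $n$-cluster tilting subcategory. Gluing along simples: write $P\cong eA$ and $I\cong D(B\epsilon)$ with primitive idempotents $e\in A$, $\epsilon\in B$, where $D=\operatorname{Hom}_K(-,K)$. Let $f_P:A\to K$ be the unique $K$-algebra homomorphism with $f_P(e)=1$, $f_P(1-e)=0$, and $g_I:B\to K$ the unique $K$-algebra homomorphism with $g_I(\epsilon)=1$, $g_I(1-\epsilon)=0$. The gluing of $A$ and $B$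 along $P$ and $I$ is the pullback algebra $\Lambda=\{(a,b)\in A\times B\mid f_P(a)=g_I(b)\}$. *)

(* Defs.v *)
From HB Require Import structures.
From mathcomp Require Import all_boot all_order all_algebra all_field.

Set Implicit Arguments.
Unset Strict Implicit.
Unset Printing Implicit Defensive.

Import GRing.Theory.
Local Open Scope ring_scope.

(* Finite-dimensional unital associative K-algebras are the [falgType K]s,     *)
(* whose unit is required to be nonzero.                                       *)
HB.instance Definition _ (K : fieldType) (A B : falgType K) :=
  GRing.UnitAlgebra.on (A * B)%type.

Record rmod (K : fieldType) (A : falgType K) := RMod {
  rmod_sort :> vectType K;
  ract : rmod_sort -> A -> rmod_sort;
  ract_linearl : forall a : A, linear (ract^~ a);
  ract_linearr : forall v : rmod_sort, linear (ract v);
  ract1 : forall v : rmod_sort, ract v 1 = v;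
  ractM : forall (v : rmod_sort) (a b : A), ract v (a * b) = ract (ract v a) b
}.

Section Modules.

Variables (K : fieldType) (A : falgType K).
Implicit Types M N P X Y : rmod A.

Definition mod_hom M N (f : 'Hom(M, N)) : Prop :=
  forall (v : M) (a : A), f (ract v a) = ract (f v) a.

Definition mod_iso M N (f : 'Hom(M, N)) : Prop := mod_hom f /\ bijective f.

Definition isomorphic M N : Prop := exists f : 'Hom(M, N), mod_iso f.

Definition zero_mod M : Prop := \dim {:M} = 0%N.

Definition dsum_act M N (v : (M * N)%type) (a : A) : (M * N)%type :=
  (ract v.1 a, ract v.2 a).

Lemma dsum_act_linearl M N (a : A) : linear ((@dsum_act M N)^~ a).
Proof. by move=> k u v; rewrite /dsum_act /= !ract_linearl. Qed.

Lemma dsum_act_linearr M N (v : (M * N)%type) : linear (dsum_act v).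
Proof. by move=> k a b; rewrite /dsum_act !ract_linearr. Qed.

Lemma dsum_act1 M N (v : (M * N)%type) : dsum_act v 1 = v.
Proof. by rewrite /dsum_act !ract1 -surjective_pairing. Qed.

Lemma dsum_actM M N (v : (M * N)%type) (a b : A) :
  dsum_act v (a * b) = dsum_act (dsum_act v a) b.
Proof. by rewrite /dsum_act !ractM. Qed.

Definition dsum M N : rmod A :=
  RMod (@dsum_act_linearl M N) (@dsum_act_linearr M N)
       (@dsum_act1 M N) (@dsum_actM M N).

Definition is_submod M (U : {vspace M}) : Prop :=
  forall (u : M) (a : A), u \in U -> ract u a \in U.

Definition simple_mod M : Prop :=
  ~ zero_mod M /\
  forall U : {vspace M}, is_submod U -> U = 0%VS \/ U = fullv.

Definition indecomposable M : Prop :=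
  ~ zero_mod M /\
  forall X Y, isomorphic M (dsum X Y) -> zero_mod X \/ zero_mod Y.

Definition projective P : Prop :=
  forall (M N : rmod A) (g : 'Hom(M, N)) (h : 'Hom(P, N)),
    mod_hom g -> mod_hom h -> limg g = fullv ->
    exists k : 'Hom(P, M), mod_hom k /\ (g \o k)%VF = h.

Definition injective_mod (J : rmod A) : Prop :=
  forall (M N : rmod A) (g : 'Hom(M, N)) (h : 'Hom(M, J)),
    mod_hom g -> mod_hom h -> lker g = 0%VS ->
    exists k : 'Hom(N, J), mod_hom k /\ (k \o g)%VF = h.

Definition representation_directed : Prop :=
  forall (t : nat) (M : nat -> rmod A) (f : forall i, 'Hom(M i, M i.+1)),
    (1 <= t)%N ->
    (forall i, (i <= t)%N -> indecomposable (M i)) ->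
    (forall i, (i < t)%N -> [/\ mod_hom (f i), f i != 0 & ~ mod_iso (f i)]) ->
    ~ isomorphic (M 0%N) (M t).

Record proj_resolution M := ProjResolution {
  res_obj : nat -> rmod A;
  res_diff : forall i, 'Hom(res_obj i.+1, res_obj i);
  res_aug : 'Hom(res_obj 0%N, M);
  res_proj : forall i, projective (res_obj i);
  res_diff_hom : forall i, mod_hom (res_diff i);
  res_aug_hom : mod_hom res_aug;
  res_aug_surj : limg res_aug = fullv;
  res_exact0 : limg (res_diff 0%N) = lker res_aug;
  res_exactS : forall i, limg (res_diff i.+1) = lker (res_diff i)
}.

Definition cocycle M N (R : proj_resolution M) (i : nat)
    (phi : 'Hom(res_obj R i, N)) : Prop :=
  mod_hom phi /\ (phi \o res_diff R i)%VF = 0.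

Definition coboundary M N (R : proj_resolution M) (i : nat) :
    'Hom(res_obj R i, N) -> Prop :=
  match i with
  | 0%N => fun phi => phi = 0
  | j.+1 => fun phi =>
      exists psi : 'Hom(res_obj R j, N),
        mod_hom psi /\ phi = (psi \o res_diff R j)%VF
  end.

(* Ext^i(M, N) is the i-th cohomology of Hom(R, N) for a projective            *)
(* resolution R of M; it does not depend on R up to isomorphism.               *)
Definition Ext_eq0 (i : nat) M N : Prop :=
  forall (R : proj_resolution M) (phi : 'Hom(res_obj R i, N)),
    cocycle phi -> coboundary phi.

Definition pd_le (m : nat) M : Prop :=
  exists R : proj_resolution M,
    forall i, (m < i)%N -> zero_mod (res_obj R i).

Definition global_dimension_le (m : nat) : Prop := forall M, pd_le m M.

Definition has_global_dimension (d : nat) : Prop :=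
  global_dimension_le d /\
  forall m, global_dimension_le m -> (d <= m)%N.

(* Full subcategories closed under isomorphism are predicates on modules.      *)
Definition n_cluster_tilting (n : nat) (C : rmod A -> Prop) : Prop :=
  [/\ (forall X Y, isomorphic X Y -> C X -> C Y),
      (forall X Y, C X -> C Y -> C (dsum X Y)),
      (forall X Y, C (dsum X Y) -> C X /\ C Y),
      (forall X, C X <->
         forall i Y, (0 < i < n)%N -> C Y -> Ext_eq0 i Y X)
    & (forall X, C X <->
         forall i Y, (0 < i < n)%N -> C Y -> Ext_eq0 i X Y)].

Definition idempotent (e : A) : Prop := e * e = e.

Definition primitive_idempotent (e : A) : Prop :=
  [/\ idempotent e, e != 0 &
      forall e1 e2 : A, idempotent e1 -> idempotent e2 ->
        e1 * e2 = 0 -> e2 * e1 = 0 -> e = e1 + e2 -> e1 = 0 \/ e2 = 0].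

Section IdempotentModules.

Variable e : A.

(* The right ideal e A. *)
Definition eA : {vspace A} := limg (amull e).

Lemma eA_memP (x : A) : reflect (exists a, x = e * a) (x \in eA).
Proof.
apply: (iffP memv_imgP) => [[a _ ->]|[a ->]]; exists a;
  by rewrite ?memvf ?lfunE.
Qed.

Definition eA_act (u : subvs_of eA) (a : A) : subvs_of eA :=
  vsproj eA (vsval u * a).

Lemma vsval_eA_act u a : vsval (eA_act u a) = vsval u * a.
Proof.
rewrite vsprojK //; have /eA_memP[b ->] := subvsP u.
by apply/eA_memP; exists (b * a); rewrite mulrA.
Qed.

Lemma eA_act_linearl (a : A) : linear (eA_act^~ a).
Proof.
by move=> k u v; rewrite /eA_act linearP /= mulrDl -scalerAl linearP.
Qed.

Lemma eA_act_linearr (u : subvs_of eA) : linear (eA_act u).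
Proof. by move=> k a b; rewrite /eA_act mulrDr -scalerAr linearP. Qed.

Lemma eA_act1 (u : subvs_of eA) : eA_act u 1 = u.
Proof. by apply: val_inj; rewrite [LHS]vsval_eA_act mulr1. Qed.

Lemma eA_actM (u : subvs_of eA) (a b : A) :
  eA_act u (a * b) = eA_act (eA_act u a) b.
Proof. by apply: val_inj; rewrite [LHS]vsval_eA_act [RHS]vsval_eA_act
  vsval_eA_act mulrA. Qed.

Definition eA_mod : rmod A :=
  RMod eA_act_linearl eA_act_linearr eA_act1 eA_actM.

(* The left ideal A e and the right module D(A e) = Hom_K(A e, K), on which    *)
(* b acts by (phi b)(x) = phi (b x).                                           *)
Definition Ae : {vspace A} := limg (amulr e).

Lemma Ae_memP (x : A) : reflect (exists a, x = a * e) (x \in Ae).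
Proof.
apply: (iffP memv_imgP) => [[a _ ->]|[a ->]]; exists a;
  by rewrite ?memvf ?lfunE.
Qed.

Definition Ae_lact (b : A) (u : subvs_of Ae) : subvs_of Ae :=
  vsproj Ae (b * vsval u).

Lemma vsval_Ae_lact b u : vsval (Ae_lact b u) = b * vsval u.
Proof.
rewrite vsprojK //; have /Ae_memP[a ->] := subvsP u.
by apply/Ae_memP; exists (b * a); rewrite mulrA.
Qed.

Lemma Ae_lact_linear (b : A) : linear (Ae_lact b).
Proof.
by move=> k u v; rewrite /Ae_lact linearP /= mulrDr -scalerAr linearP.
Qed.

HB.instance Definition _ (b : A) :=
  GRing.isLinear.Build K (subvs_of Ae) (subvs_of Ae) *:%R (Ae_lact b)
    (Ae_lact_linear b).

Definition DAe_act (phi : 'Hom(subvs_of Ae, K^o)) (b : A) :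
    'Hom(subvs_of Ae, K^o) :=
  (phi \o linfun (Ae_lact b))%VF.

Lemma DAe_actE phi b u : DAe_act phi b u = phi (Ae_lact b u).
Proof. by rewrite /DAe_act comp_lfunE lfunE. Qed.

Lemma DAe_act_linearl (b : A) : linear (DAe_act^~ b).
Proof.
move=> k phi psi; apply/lfunP => u.
by rewrite !(add_lfunE, scale_lfunE, DAe_actE).
Qed.

Lemma DAe_act_linearr (phi : 'Hom(subvs_of Ae, K^o)) : linear (DAe_act phi).
Proof.
move=> k a b; apply/lfunP => u.
rewrite !(add_lfunE, scale_lfunE, DAe_actE) -linearP; congr (phi _).
by rewrite /Ae_lact mulrDl -scalerAl linearP.
Qed.

Lemma DAe_act1 (phi : 'Hom(subvs_of Ae, K^o)) : DAe_act phi 1 = phi.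
Proof.
apply/lfunP => u; rewrite DAe_actE; congr (phi _).
by apply: val_inj; rewrite [LHS]vsval_Ae_lact mul1r.
Qed.

Lemma DAe_actM (phi : 'Hom(subvs_of Ae, K^o)) (a b : A) :
  DAe_act phi (a * b) = DAe_act (DAe_act phi a) b.
Proof.
apply/lfunP => u; rewrite !DAe_actE; congr (phi _).
by apply: val_inj; rewrite [LHS]vsval_Ae_lact [RHS]vsval_Ae_lact
  vsval_Ae_lact mulrA.
Qed.

Definition DAe_mod : rmod A :=
  RMod DAe_act_linearl DAe_act_linearr DAe_act1 DAe_actM.

End IdempotentModules.

(* A has a complete set of primitive orthogonal idempotents e_i such that the  *)
(* modules e_i A are pairwise nonisomorphic.                                   *)
Definition basic_algebra : Prop :=
  exists (m : nat) (e : 'I_m -> A),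
    [/\ (forall i, primitive_idempotent (e i)),
        (forall i j, i != j -> e i * e j = 0),
        \sum_(i < m) e i = 1
      & (forall i j, i != j -> ~ isomorphic (eA_mod (e i)) (eA_mod (e j)))].

End Modules.

Arguments representation_directed {K} A.
Arguments has_global_dimension {K} A d.
Arguments basic_algebra {K} A.

Definition strongly_representation_directed (n d : nat) (K : fieldType)
    (A : falgType K) : Prop :=
  [/\ basic_algebra A, representation_directed A, has_global_dimension A d
    & exists C : rmod A -> Prop, n_cluster_tilting n C].

Section Gluing.

Variables (K : fieldType) (A B : falgType K).
Variables (f : {lrmorphism A -> K^o}) (g : {lrmorphism B -> K^o}).

Definition gluing_diff (x : (A * B)%type) : K^o := f x.1 - g x.2.

Lemma gluing_diff_linear : linear gluing_diff.
Proof.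
by move=> k x y; rewrite /gluing_diff /= !linearD !linearZ /= addrACA.
Qed.

HB.instance Definition _ :=
  GRing.isLinear.Build K (A * B)%type K^o *:%R gluing_diff gluing_diff_linear.

Definition gluing_space : {vspace (A * B)%type} := lker (linfun gluing_diff).

Lemma mem_gluing_space (x : (A * B)%type) :
  (x \in gluing_space) = (f x.1 == g x.2).
Proof. by rewrite memv_ker lfunE /= subr_eq0. Qed.

Lemma gluing_is_aspace : is_aspace gluing_space.
Proof.
rewrite /is_aspace has_algid1 ?mem_gluing_space ?rmorph1 //=.
apply/prodvP => x y; rewrite !mem_gluing_space /= !rmorphM /=.
by move=> /eqP-> /eqP->.
Qed.

(* The pullback {(a, b) | f a = g b}, as a unital subalgebra of A * B.         *)
Definition gluing_aspace : {aspace (A * B)%type} := ASpace gluing_is_aspace.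

Definition gluing : falgType K := subvs_of gluing_aspace.

Lemma gluing_val1 : vsval (1 : gluing) = 1.
Proof.
by apply/eqP; rewrite algid_eq1 mem_gluing_space !rmorph1.
Qed.

End Gluing.

(* Main.v *)
From HB Require Import structures.
Require Import Defs.
From mathcomp Require Import all_boot all_order all_algebra all_field.
From Stdlib Require Import Classical.

Set Implicit Arguments.
Unset Strict Implicit.
Unset Printing Implicit Defensive.

Import GRing.Theory.
Local Open Scope ring_scope.

(** Write [G] for the gluing and [S] for the one-dimensional module on which
    [A], [B] and [G] act through [f], [g] and their common value [chi].  As
    [e A] is simple, [e a = f(a) e]; as [D(B eps)] is simple,
    [b eps = g(b) eps].  Hence [S] is projective over [A]
    ([scal_projective]) and injective over [B] ([scal_injective]), and so are
    its direct sums.  These two identities carry the whole proof.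

    Modules.  The elements [(1, eps)] and [(e, 1)] of [G] are idempotents that
    generate copies of [A] and [B], and their intersection is the vertex
    [(e, eps)].  Every [G]-module is the direct sum of an [A]-module and a
    [B]-module ([decompose]): the first summand is the largest submodule on
    which [G] acts through [A].  A map between an [A]-module and a [B]-module,
    in either direction, takes values in a sum of copies of [S]
    ([mixed_hom_scalar]).

    Representation-directedness.  Let [h] be a nonzero map from an
    indecomposable [A]-module to an indecomposable [B]-module.  It passes
    through copies of [S], so it splits off a common summand and is an
    isomorphism ([isA_isB_iso]).  A cycle of nonzero nonisomorphisms thus
    stays among the [A]-modules or among the [B]-modules.

    Extensions.  Free [B]-modules are projective over [G].  Free [A]-modules
    need not be, but up to [G]-projectives they are sums of copies of [S], which
    are also [B]-modules ([free_resA_stable]).  Dimension shifting along free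
    covers over [A] and over [B] gives, for [A]-modules [X], [X'], for
    [B]-modules [Y], [Y'] and for [i > 0]: Ext^i over [G] agrees with Ext^i
    over [A] on [(X, X')] and with Ext^i over [B] on [(Y, Y')]; it vanishes on
    [(Y, X)]; and it vanishes on [(X, Y)] as soon as Ext^i(X, S) and
    Ext^j(S, Y) vanish over [A] and [B] for [0 < j <= i] ([ext_vanish_AA],
    [ext_vanish_BB], [ext_vanish_BA], [ext_vanish_AB]).

    Global dimension.  The comparison bounds the global dimension of [G] below
    by those of [A] and [B].  [B]-modules have projective dimension at most
    [d2] over [G], hence so do free [A]-modules, and an [A]-module is resolved
    in [d1] steps by [A]-projectives: this gives the upper bound [d1 + d2].

    Cluster tilting.  The sums [X (+) Y] with [X] in the subcategory chosen
    for [A] and [Y] in the one chosen for [B] work: projectives and injectives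
    lie in every cluster tilting subcategory, so [S] lies in both, and the
    vanishing on [(X, Y)] applies ([glue_cluster_tilting]).

    Ext is handled through syzygies: [ext_vanish i M N] expresses that
    Ext^(i+1)(M, N) is zero without choosing a resolution. *)

(** * Linear maps and module homomorphisms *)

Section HomBasics.

Variables (K : fieldType) (A : falgType K).
Implicit Types M N L P Q X Y : rmod A.

HB.instance Definition _ M (v : M) :=
  GRing.isLinear.Build K A M *:%R (ract v) (ract_linearr v).

Section ActionLinearity.

Variable M : rmod A.
Implicit Types (u v : M) (a b : A).

Definition ractl a : M -> M := (ract (r := M))^~ a.

HB.instance Definition _ a :=
  GRing.isLinear.Build K M M *:%R (ractl a) (@ract_linearl _ _ M a).

Lemma ractDl u v a : ract (u + v) a = ract u a + ract v a.
Proof. exact: (linearD (ractl a)). Qed.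
Lemma ractBl u v a : ract (u - v) a = ract u a - ract v a.
Proof. exact: (linearB (ractl a)). Qed.
Lemma ractZl k v a : ract (k *: v) a = k *: ract v a.
Proof. by rewrite -[LHS]/(ractl a (k *: v)) linearZ. Qed.
Lemma ract0l a : ract (0 : M) a = 0.
Proof. exact: (linear0 (ractl a)). Qed.
Lemma ract_suml I (s : seq I) (P : pred I) (F : I -> M) a :
  ract (\sum_(i <- s | P i) F i) a = \sum_(i <- s | P i) ract (F i) a.
Proof. exact: (linear_sum (ractl a)). Qed.
Lemma ractDr v a b : ract v (a + b) = ract v a + ract v b.
Proof. exact: linearD. Qed.
Lemma ractBr v a b : ract v (a - b) = ract v a - ract v b.
Proof. exact: linearB. Qed.
Lemma ractZr k v a : ract v (k *: a) = k *: ract v a.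
Proof. exact: linearZ. Qed.
Lemma ract0r v : ract v (0 : A) = 0.
Proof. exact: linear0. Qed.

End ActionLinearity.

Definition surj (U V : Type) (g : U -> V) := forall y, exists x, g x = y.

Lemma limg_surj (U V : vectType K) (g : 'Hom(U, V)) :
  limg g = fullv <-> surj g.
Proof.
split=> [Hg y|Hg].
  have : y \in limg g by rewrite Hg memvf.
  by case/memv_imgP=> x _ ->; exists x.
apply/eqP; rewrite eqEsubv subvf; apply/subvP=> y _.
by have [x <-] := Hg y; apply: memv_img; apply: memvf.
Qed.

Lemma lfun_rinv (U V : vectType K) (g : 'Hom(U, V)) :
  surj g -> forall y, g (g^-1%VF y) = y.
Proof. by move/limg_surj=> Hg y; apply: limg_lfunVK; rewrite Hg memvf. Qed.

Lemma lfun_linv (U V : vectType K) (g : 'Hom(U, V)) :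
  injective g -> forall x, g^-1%VF (g x) = x.
Proof. by move/lker0P=> Hg x; apply: lker0_lfunK. Qed.

Lemma lfun_linear (U V : vectType K) (f : U -> V) :
  linear f -> exists g : 'Hom(U, V), g =1 f.
Proof.
move=> Hf; pose F := HB.pack_for {linear U -> V} f
  (GRing.isLinear.Build K U V *:%R f Hf).
by exists (linfun F) => x; rewrite lfunE.
Qed.

Lemma hom_id M : mod_hom (\1%VF : 'Hom(M, M)).
Proof. by move=> v a; rewrite !id_lfunE. Qed.

Lemma hom_0 M N : mod_hom (0 : 'Hom(M, N)).
Proof. by move=> v a; rewrite !zero_lfunE ract0l. Qed.

Lemma hom_comp M N L (g : 'Hom(N, L)) (f : 'Hom(M, N)) :
  mod_hom g -> mod_hom f -> mod_hom (g \o f)%VF.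
Proof. by move=> Hg Hf v a; rewrite !comp_lfunE Hf Hg. Qed.

Lemma hom_add M N (f g : 'Hom(M, N)) :
  mod_hom f -> mod_hom g -> mod_hom (f + g).
Proof. by move=> Hf Hg v a; rewrite !add_lfunE Hf Hg ractDl. Qed.

Lemma hom_sub M N (f g : 'Hom(M, N)) :
  mod_hom f -> mod_hom g -> mod_hom (f - g).
Proof. by move=> Hf Hg v a; rewrite !(add_lfunE, opp_lfunE) Hf Hg ractBl. Qed.

(** The linear quasi-inverse [g^-1] of a surjection is only linear, but
    composing it with a map that kills [ker g] makes it equivariant. *)
Lemma factor_surj M N X (g : 'Hom(M, N)) (h : 'Hom(M, X)) :
    mod_hom g -> mod_hom h -> surj g -> (forall m, g m = 0 -> h m = 0) ->
  exists2 k : 'Hom(N, X), mod_hom k & forall m, k (g m) = h m.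
Proof.
move=> Hg Hh Sg Hgh.
have hE m m' : g m = g m' -> h m = h m'.
  move=> E; apply/eqP; rewrite -subr_eq0 -linearB; apply/eqP/Hgh.
  by rewrite linearB /= E subrr.
have Ek m : h (g^-1%VF (g m)) = h m by apply: hE; rewrite lfun_rinv.
exists (h \o g^-1)%VF => [v a|m]; last by rewrite comp_lfunE.
have [m <-] := Sg v.
by rewrite -Hg !comp_lfunE !Ek Hh.
Qed.

Lemma factor_inj L M X (i : 'Hom(L, X)) (h : 'Hom(M, X)) :
    mod_hom i -> mod_hom h -> injective i ->
    (forall m, exists l, h m = i l) ->
  exists2 k : 'Hom(M, L), mod_hom k & forall m, i (k m) = h m.
Proof.
move=> Hi Hh Ii Hih.
have Ek m : i (i^-1%VF (h m)) = h m.
  by have [l ->] := Hih m; rewrite lfun_linv.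
exists (i^-1 \o h)%VF => [v a|m]; last by rewrite comp_lfunE.
by apply: Ii; rewrite Hi !comp_lfunE !Ek Hh.
Qed.

Lemma projective_lift P M N (g : 'Hom(M, N)) (h : 'Hom(P, N)) :
    projective P -> mod_hom g -> mod_hom h -> surj g ->
  exists2 k : 'Hom(P, M), mod_hom k & forall x, g (k x) = h x.
Proof.
move=> HP Hg Hh /limg_surj Sg; have [k [Hk E]] := HP _ _ _ _ Hg Hh Sg.
by exists k => // x; rewrite -E comp_lfunE.
Qed.

(** Projectivity with surjectivity and the lifting property read pointwise, the
    form in which both are produced and used here. *)
Lemma projectiveP P :
  (forall M N (g : 'Hom(M, N)) (h : 'Hom(P, N)),
     mod_hom g -> mod_hom h -> surj g ->
     exists2 k : 'Hom(P, M), mod_hom k & forall x, g (k x) = h x) ->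
  projective P.
Proof.
move=> H M N g h Hg Hh /limg_surj Sg; have [k Hk E] := H _ _ _ _ Hg Hh Sg.
by exists k; split=> //; apply/lfunP=> x; rewrite comp_lfunE.
Qed.

Lemma projective_retract P Q (s : 'Hom(P, Q)) (r : 'Hom(Q, P)) :
    mod_hom s -> mod_hom r -> (forall x, r (s x) = x) -> projective Q ->
  projective P.
Proof.
move=> Hs Hr rs HQ; apply: projectiveP => M N g h Hg Hh Sg.
have [k Hk E] := projective_lift HQ Hg (hom_comp Hh Hr) Sg.
exists (k \o s)%VF; first exact: hom_comp.
by move=> x; rewrite comp_lfunE E comp_lfunE rs.
Qed.

Lemma zero_modP M : zero_mod M <-> forall x : M, x = 0.
Proof.
rewrite /zero_mod; split=> [/eqP|H].
  by rewrite dimv_eq0 => /eqP E x; apply/eqP; rewrite -memv0 -E memvf.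
apply/eqP; rewrite dimv_eq0 -subv0; apply/subvP=> x _.
by rewrite (H x) mem0v.
Qed.

(** * Submodules and short exact sequences *)

Section Submodule.

Variables (M : rmod A) (U : {vspace M}) (HU : is_submod U).

Definition sub_act (u : subvs_of U) (a : A) : subvs_of U :=
  vsproj U (ract (vsval u) a).

Lemma vsval_sub_act u a : vsval (sub_act u a) = ract (vsval u) a.
Proof. by rewrite vsprojK //; apply/HU/subvsP. Qed.

Fact sub_act_linearl a : linear (sub_act^~ a).
Proof.
by move=> k u v; apply: val_inj; rewrite /= !(linearP, vsval_sub_act) /=
  ractDl ractZl.
Qed.

Fact sub_act_linearr u : linear (sub_act u).
Proof. by move=> k a b; apply: val_inj; rewrite /= !(linearP, vsval_sub_act). Qed.

Fact sub_act1 u : sub_act u 1 = u.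
Proof. by apply: val_inj; rewrite /= vsval_sub_act ract1. Qed.

Fact sub_actM u a b : sub_act u (a * b) = sub_act (sub_act u a) b.
Proof. by apply: val_inj; rewrite /= !vsval_sub_act ractM. Qed.

Definition sub_mod : rmod A :=
  RMod sub_act_linearl sub_act_linearr sub_act1 sub_actM.

Definition sub_incl : 'Hom(sub_mod, M) := linfun (@vsval K M U).

Lemma sub_inclE u : sub_incl u = vsval u.
Proof. by rewrite lfunE. Qed.

Lemma hom_sub_incl : mod_hom sub_incl.
Proof. by move=> u a; rewrite !sub_inclE vsval_sub_act. Qed.

Lemma sub_incl_inj : injective sub_incl.
Proof. by move=> u v; rewrite !sub_inclE; apply: val_inj. Qed.

Lemma mem_sub_incl x : reflect (exists u, x = sub_incl u) (x \in U).
Proof.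
apply: (iffP idP) => [xU|[u ->]]; last by rewrite sub_inclE; apply: subvsP.
by exists (vsproj U x); rewrite sub_inclE vsprojK.
Qed.

End Submodule.

Lemma lker_submod M N (f : 'Hom(M, N)) : mod_hom f -> is_submod (lker f).
Proof. by move=> Hf u a; rewrite !memv_ker Hf => /eqP ->; rewrite ract0l. Qed.

Lemma limg_submod M N (f : 'Hom(M, N)) : mod_hom f -> is_submod (limg f).
Proof.
move=> Hf u a /memv_imgP[x _ ->]; rewrite -Hf.
by apply: memv_img; apply: memvf.
Qed.

Definition ses L X M (k : 'Hom(L, X)) (p : 'Hom(X, M)) : Prop :=
  [/\ mod_hom k, mod_hom p, injective k, surj p
    & forall x, p x = 0 <-> exists l, x = k l].

Lemma ses_pk L X M (k : 'Hom(L, X)) (p : 'Hom(X, M)) :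
  ses k p -> forall l, p (k l) = 0.
Proof. by case=> _ _ _ _ H l; apply/H; exists l. Qed.

Lemma ker_ses X M (p : 'Hom(X, M)) : mod_hom p -> surj p ->
  exists (L : rmod A) (k : 'Hom(L, X)), ses k p.
Proof.
move=> Hp Sp; exists (sub_mod (lker_submod Hp)), (sub_incl (lker_submod Hp)).
split=> //; [exact: hom_sub_incl | exact: sub_incl_inj |].
move=> x; split=> [E|[u ->]].
  by apply/(mem_sub_incl (lker_submod Hp)); rewrite memv_ker E.
by apply/eqP; rewrite -memv_ker; apply/(mem_sub_incl (lker_submod Hp)); exists u.
Qed.

(** * Direct sums and free modules *)

Lemma hom_pair X M N (f : 'Hom(X, M)) (g : 'Hom(X, N)) :
    mod_hom f -> mod_hom g ->
  exists2 h : 'Hom(X, dsum M N), mod_hom h & forall x, h x = (f x, g x).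
Proof.
move=> Hf Hg.
have L : linear ((fun x => (f x, g x)) : X -> dsum M N).
  by move=> k x y; rewrite !linearP.
have [h E] := lfun_linear L; exists h => // x a.
by rewrite !E /= /dsum_act /= Hf Hg.
Qed.

Lemma hom_copair M N X (f : 'Hom(M, X)) (g : 'Hom(N, X)) :
    mod_hom f -> mod_hom g ->
  exists2 h : 'Hom(dsum M N, X),
    mod_hom h & forall z : (M * N)%type, h z = f z.1 + g z.2.
Proof.
move=> Hf Hg.
have L : linear ((fun z : (M * N)%type => f z.1 + g z.2) : dsum M N -> X).
  by move=> k x y; rewrite /= !linearP /= scalerDr addrACA.
have [h E] := lfun_linear L; exists h => // x a.
by rewrite !E /= Hf Hg ractDl.
Qed.

Section Free.

Variable n : nat.

Definition free_act (x : {ffun 'I_n -> A}) (a : A) : {ffun 'I_n -> A} :=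
  [ffun i => x i * a].

Fact free_act_linearl a : linear (free_act^~ a).
Proof. by move=> k u v; apply/ffunP=> i; rewrite !ffunE mulrDl -scalerAl. Qed.

Fact free_act_linearr x : linear (free_act x).
Proof. by move=> k a b; apply/ffunP=> i; rewrite !ffunE mulrDr -scalerAr. Qed.

Fact free_act1 x : free_act x 1 = x.
Proof. by apply/ffunP=> i; rewrite !ffunE mulr1. Qed.

Fact free_actM x a b : free_act x (a * b) = free_act (free_act x a) b.
Proof. by apply/ffunP=> i; rewrite !ffunE mulrA. Qed.

Definition free_mod : rmod A :=
  RMod free_act_linearl free_act_linearr free_act1 free_actM.

Lemma free_hom M (m : 'I_n -> M) :
  exists2 h : 'Hom(free_mod, M), mod_hom h
    & forall x : {ffun 'I_n -> A}, h x = \sum_i ract (m i) (x i).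
Proof.
have L : linear ((fun x : {ffun 'I_n -> A} => \sum_i ract (m i) (x i))
  : free_mod -> M).
  move=> k x y; rewrite scaler_sumr -big_split /=; apply: eq_bigr => i _.
  by rewrite !ffunE ractDr ractZr.
have [h E] := lfun_linear L; exists h => // x a.
rewrite !E ract_suml; apply: eq_bigr => i _.
by rewrite /= /free_act ffunE ractM.
Qed.

Lemma free_projective : projective free_mod.
Proof.
apply: projectiveP => M N g h Hg Hh Sg.
pose dl i : free_mod := [ffun j => (i == j)%:R : A].
have [k Hk Ek] := free_hom (fun i => g^-1%VF (h (dl i))).
exists k => // x; rewrite Ek linear_sum /=.
have -> : x = \sum_i ract (dl i) (x i).
  apply/ffunP=> j; rewrite sum_ffunE (bigD1 j) //= /free_act !ffunE eqxx mul1r.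
  by rewrite big1 ?addr0 // => i /negPf E; rewrite !ffunE E mul0r.
rewrite linear_sum /=; apply: eq_bigr => i _.
rewrite Hg lfun_rinv // Hh; congr ract.
rewrite sum_ffunE (bigD1 i) //= /free_act !ffunE eqxx mul1r.
by rewrite big1 ?addr0 // => j /negPf E; rewrite !ffunE E mul0r.
Qed.

End Free.

Lemma free_cover M :
  exists (n : nat) (p : 'Hom(free_mod n, M)), mod_hom p /\ surj p.
Proof.
exists (\dim {:M}).
have [p Hp Ep] := free_hom (fun i : 'I_(\dim {:M}) => (vbasis {:M})`_i).
exists p; split=> // v.
pose x : {ffun 'I_(\dim {:M}) -> A} := [ffun i => coord (vbasis {:M}) i v *: 1].
exists x.
rewrite Ep {1}(coord_vbasis (memvf v)); apply: eq_bigr => i _.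
by rewrite /x ffunE ractZr ract1.
Qed.

Lemma proj_cover M : exists (Q L : rmod A) (k : 'Hom(L, Q)) (p : 'Hom(Q, M)),
  projective Q /\ ses k p.
Proof.
have [n [p [Hp Sp]]] := free_cover M.
have [L [k S]] := ker_ses Hp Sp.
by exists (free_mod n), L, k, p; split=> //; apply: free_projective.
Qed.

End HomBasics.

(** * Vanishing of Ext by dimension shifting *)

Section Ext.

Variables (K : fieldType) (A : falgType K).
Implicit Types M N L P Q X Y Z : rmod A.

Definition lfun_simpl := (@add_lfunE, @opp_lfunE, @comp_lfunE, @id_lfunE,
  @zero_lfunE).

(** [M'] is a retract of [M] up to a projective summand.  This is the relation
    that passes to syzygies computed from arbitrary, unrelated projective
    covers, so one induction on it gives at once the independence of Ext from
    the chosen covers and its behaviour under direct summands. *)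
Definition stable_retract M' M : Prop :=
  exists (T : rmod A) (s : 'Hom(M', M)) (r : 'Hom(M, M'))
         (j : 'Hom(M', T)) (h : 'Hom(T, M')),
    [/\ projective T, mod_hom s, mod_hom r, mod_hom j /\ mod_hom h
      & forall x, x = r (s x) + h (j x)].

(** The vanishing of Ext^(i+1)(M, N), mind the shift by one: Ext^1 vanishes when
    maps from a syzygy of [M] extend to the projective cover, and higher
    degrees are reached by replacing [M] by a syzygy. *)
Fixpoint ext_vanish (i : nat) M N : Prop :=
  match i with
  | 0%N => forall L Q (k : 'Hom(L, Q)) (p : 'Hom(Q, M)),
      projective Q -> ses k p ->
      forall phi : 'Hom(L, N), mod_hom phi ->
      exists2 psi : 'Hom(Q, N), mod_hom psi & forall x, psi (k x) = phi x
  | j.+1 => forall L Q (k : 'Hom(L, Q)) (p : 'Hom(Q, M)),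
      projective Q -> ses k p -> ext_vanish j L N
  end.

Lemma retract_stable M' M (s : 'Hom(M', M)) (r : 'Hom(M, M')) :
  mod_hom s -> mod_hom r -> (forall x, r (s x) = x) -> stable_retract M' M.
Proof.
move=> Hs Hr rs; have [Q [_ [_ [_ [HQ _]]]]] := proj_cover M.
exists Q, s, r, 0, 0; split=> //; first by split; apply: hom_0.
by move=> x; rewrite rs !zero_lfunE addr0.
Qed.

Lemma stable_retract_refl M : stable_retract M M.
Proof.
by apply: (@retract_stable _ _ \1%VF \1%VF) => [||x];
  rewrite ?id_lfunE //; apply: hom_id.
Qed.

(** Lift [s] and [r] to maps [a] and [b] between the covers.  The difference
    [1 - b a] covers [1 - r s = h j], so after a lift of [h] is subtracted it
    lands in the syzygy [L'], which gives [eta]. *)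
Lemma syzygy_comparison M' M L' Q' L Q
    (k' : 'Hom(L', Q')) (p' : 'Hom(Q', M')) (k : 'Hom(L, Q)) (p : 'Hom(Q, M)) :
    stable_retract M' M -> ses k' p' -> ses k p ->
    projective Q' -> projective Q ->
  exists (s : 'Hom(L', L)) (r : 'Hom(L, L')) (a : 'Hom(Q', Q))
         (eta : 'Hom(Q', L')),
    [/\ mod_hom s /\ mod_hom r, mod_hom a, mod_hom eta,
        forall x, k (s x) = a (k' x)
      & forall x, x = r (s x) + eta (k' x)].
Proof.
move=> [T [s [r [j [h [HT Hs Hr [Hj Hh] E]]]]]] S' S HQ' HQ.
have [Hk' Hp' Ik' Sp' Ek'] := S'; have [Hk Hp Ik Sp Ek] := S.
have [a Ha Ea] := projective_lift HQ' Hp (hom_comp Hs Hp') Sp.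
have [b Hb Eb] := projective_lift HQ Hp' (hom_comp Hr Hp) Sp'.
have [c Hc Ec] := projective_lift HT Hp' Hh Sp'.
have {}Ea x : p (a x) = s (p' x) by rewrite Ea comp_lfunE.
have {}Eb x : p' (b x) = r (p x) by rewrite Eb comp_lfunE.
have [||l|s' Hs' Es] := @factor_inj _ _ _ _ _ k (a \o k')%VF Hk => //.
- exact: hom_comp.
- by apply/Ek; rewrite comp_lfunE Ea (ses_pk S') linear0.
have [||l|r' Hr' Er] := @factor_inj _ _ _ _ _ k' (b \o k)%VF Hk' => //.
- exact: hom_comp.
- by apply/Ek'; rewrite comp_lfunE Eb (ses_pk S) linear0.
pose d := (\1 - (b \o a) - (c \o (j \o p')))%VF.
have Hd : mod_hom d.
  apply: hom_sub; last by do 2![apply: hom_comp => //].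
  by apply: hom_sub; [apply: hom_id | apply: hom_comp].
have [x|eta He Ee] := @factor_inj _ _ _ _ _ k' d Hk' Hd Ik'.
  apply/Ek'; rewrite !lfun_simpl !linearB /= Eb Ea Ec {1}(E (p' x)).
  by rewrite -addrA -opprD subrr.
exists s', r', a, eta; split=> //.
  by move=> x; rewrite Es comp_lfunE.
move=> x; apply: Ik'; rewrite linearD /= Er comp_lfunE Es Ee !lfun_simpl.
by rewrite (ses_pk S') !linear0 addr0 addrC subrK.
Qed.

Lemma ext_vanish_stable i M' M N :
  stable_retract M' M -> ext_vanish i M N -> ext_vanish i M' N.
Proof.
elim: i M' M => [|i IH] M' M SR E L' Q' k' p' HQ' S'.
all: have [Q [L [k [p [HQ S]]]]] := proj_cover M.
all: have [s [r [a [eta [[Hs Hr] Ha He Es Er]]]]] :=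
       syzygy_comparison SR S' S HQ' HQ.
- move=> phi Hphi.
  have [psi Hpsi Epsi] := E _ _ _ _ HQ S _ (hom_comp Hphi Hr).
  exists ((psi \o a) + (phi \o eta))%VF; first by apply: hom_add; apply: hom_comp.
  move=> x; rewrite !lfun_simpl -Es Epsi comp_lfunE -linearD /=.
  by rewrite -(Er x).
- apply: (IH _ L); last exact: E HQ S.
  exists Q', s, r, k', eta; split=> //.
  by case: S' => Hk' _ _ _ _; split.
Qed.

Lemma ext_vanish_retract i M' M N (s : 'Hom(M', M)) (r : 'Hom(M, M')) :
    mod_hom s -> mod_hom r -> (forall x, r (s x) = x) ->
  ext_vanish i M N -> ext_vanish i M' N.
Proof. by move=> Hs Hr rs; apply/ext_vanish_stable/(retract_stable Hs). Qed.

Lemma ext_vanish_retract_r i M N N' (s : 'Hom(N', N)) (r : 'Hom(N, N')) :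
    mod_hom s -> mod_hom r -> (forall x, r (s x) = x) ->
  ext_vanish i M N -> ext_vanish i M N'.
Proof.
move=> Hs Hr rs; elim: i M => [|i IH] M E L Q k p HQ S; last first.
  exact/IH/(E _ _ _ _ HQ S).
move=> phi Hphi; have [psi Hpsi Epsi] := E _ _ _ _ HQ S _ (hom_comp Hs Hphi).
exists (r \o psi)%VF; first exact: hom_comp.
by move=> x; rewrite comp_lfunE Epsi comp_lfunE rs.
Qed.

Lemma ext_vanish_dsum_r i M N1 N2 :
  ext_vanish i M N1 -> ext_vanish i M N2 -> ext_vanish i M (dsum N1 N2).
Proof.
elim: i M => [|i IH] M E1 E2 L Q k p HQ S; last first.
  by apply: IH; [apply: E1 HQ S | apply: E2 HQ S].
move=> phi Hphi.
have [f1 H1 F1] := hom_copair (@hom_id _ _ N1) (@hom_0 _ _ N2 N1).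
have [f2 H2 F2] := hom_copair (@hom_0 _ _ N1 N2) (@hom_id _ _ N2).
have [g1 G1 Eg1] := E1 _ _ _ _ HQ S _ (hom_comp H1 Hphi).
have [g2 G2 Eg2] := E2 _ _ _ _ HQ S _ (hom_comp H2 Hphi).
have [g G Eg] := hom_pair G1 G2.
exists g => // x; rewrite Eg Eg1 Eg2 !comp_lfunE F1 F2 !lfun_simpl addr0 add0r.
by rewrite -surjective_pairing.
Qed.

Lemma ext_vanish_projective i P N : projective P -> ext_vanish i P N.
Proof.
elim: i P => [|i IH] P HP L Q k p HQ S; have [Hk Hp Ik Sp Ek] := S;
  have [t Ht Et] := projective_lift HP Hp (@hom_id _ _ P) Sp.
all: have Hd : mod_hom (\1 - (t \o p))%VF
  by apply: hom_sub; [apply: hom_id | apply: hom_comp].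
all: have [x|r Hr Er] := @factor_inj _ _ _ _ _ k _ Hk Hd Ik;
  first by apply/Ek; rewrite !lfun_simpl linearB /= Et id_lfunE subrr.
all: have rk x : r (k x) = x
  by apply: Ik; rewrite Er !lfun_simpl (ses_pk S) linear0 subr0.
- move=> phi Hphi; exists (phi \o r)%VF; first exact: hom_comp.
  by move=> x; rewrite comp_lfunE rk.
- exact/IH/(projective_retract Hk Hr rk).
Qed.

Lemma ext_vanish_injective i M N : injective_mod N -> ext_vanish i M N.
Proof.
move=> HN; elim: i M => [|i IH] M L Q k p HQ S; last exact: IH.
have [Hk _ Ik _ _] := S => phi Hphi.
have [|psi [Hpsi E]] := HN _ _ k phi Hk Hphi; first by apply/eqP/lker0P.
by exists psi => // x; rewrite -E comp_lfunE.
Qed.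

(** One projective cover is enough to decide vanishing: the kernels of any two
    are stable retracts of each other.  The same holds in the lowest degree
    for [ext_vanish0]. *)
Lemma ext_vanish_syzygy i L Q M N (k : 'Hom(L, Q)) (p : 'Hom(Q, M)) :
  projective Q -> ses k p -> ext_vanish i L N -> ext_vanish i.+1 M N.
Proof.
move=> HQ S E L' Q' k' p' HQ' S'.
have [s [r [a [eta [[Hs Hr] Ha He Es Er]]]]] :=
  syzygy_comparison (stable_retract_refl M) S' S HQ' HQ.
apply: ext_vanish_stable E; exists Q', s, r, k', eta; split=> //.
by case: S'.
Qed.

Lemma ext_vanish0 L Q M N (k : 'Hom(L, Q)) (p : 'Hom(Q, M)) :
    projective Q -> ses k p ->
    (forall phi : 'Hom(L, N), mod_hom phi ->
     exists2 psi : 'Hom(Q, N), mod_hom psi & forall x, psi (k x) = phi x) ->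
  ext_vanish 0 M N.
Proof.
move=> HQ S E L' Q' k' p' HQ' S' phi Hphi.
have [s [r [a [eta [[Hs Hr] Ha He Es Er]]]]] :=
  syzygy_comparison (stable_retract_refl M) S' S HQ' HQ.
have [psi Hpsi Epsi] := E _ (hom_comp Hphi Hr).
exists ((psi \o a) + (phi \o eta))%VF; first by apply: hom_add; apply: hom_comp.
move=> x; rewrite !lfun_simpl -Es Epsi comp_lfunE -linearD /=.
by rewrite -(Er x).
Qed.

(** For Ext^1 the middle term need not be projective: lift a projective cover
    [Q] of [M] to [X]; then [X] is a quotient of [Q (+) L], on which the
    extension is defined by pieces. *)
Lemma ext_vanish_extend L X M N (k : 'Hom(L, X)) (p : 'Hom(X, M)) :
    ext_vanish 0 M N -> ses k p -> forall phi : 'Hom(L, N), mod_hom phi ->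
  exists2 psi : 'Hom(X, N), mod_hom psi & forall x, psi (k x) = phi x.
Proof.
move=> E S phi Hphi; have [Hk Hp Ik Sp Ek] := S.
have [Q [Z [z [q [HQ SQ]]]]] := proj_cover M; have [Hz Hq Iz Sq Ez] := SQ.
have [t Ht Et] := projective_lift HQ Hp Hq Sp.
have [||l|u Hu Eu] := @factor_inj _ _ _ _ _ k (t \o z)%VF Hk => //.
- exact: hom_comp.
- by apply/Ek; rewrite comp_lfunE Et (ses_pk SQ).
have {}Eu x : k (u x) = t (z x) by rewrite Eu comp_lfunE.
have [psi Hpsi Epsi] := E _ _ _ _ HQ SQ _ (hom_comp Hphi Hu).
have {}Epsi x : psi (z x) = phi (u x) by rewrite Epsi comp_lfunE.
have [F HF EF] := hom_copair Ht Hk.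
have [G HG EG] := hom_copair Hpsi Hphi.
have [||chi Hchi Echi] := factor_surj HF HG.
- move=> x; have [y Ey] := Sq (p x).
  have /Ek[l El] : p (x - t y) = 0 by rewrite linearB /= Et Ey subrr.
  by exists (y, l); rewrite EF /= -El addrC subrK.
- move=> [y l]; rewrite EF EG /= => Eyl.
  have /Ez[w Ew] : q y = 0.
    by have := congr1 p Eyl; rewrite linearD linear0 /= (ses_pk S) addr0 Et.
  move: Eyl; rewrite Ew -Eu -linearD -(linear0 k) => /Ik Eyl.
  by rewrite Epsi -linearD /= Eyl linear0.
exists chi => // x; have := Echi (0, x).
by rewrite EF EG /= !linear0 !add0r.
Qed.

(** * Long exact sequences *)

(** If [Z] is the kernel of a cover [Q] of [M] and [Z2] the kernel of the
    composite cover of the quotient [M2], then [Z2 / Z] is the subobject [M1].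
    This rotation of short exact sequences replaces the horseshoe lemma. *)
Lemma cover_rotation M1 M M2 Q (i : 'Hom(M1, M)) (q : 'Hom(M, M2))
    (Z : rmod A) (z : 'Hom(Z, Q)) (p : 'Hom(Q, M)) :
    ses i q -> ses z p ->
  exists (Z2 : rmod A) (z2 : 'Hom(Z2, Q)) (j : 'Hom(Z, Z2)) (w : 'Hom(Z2, M1)),
    [/\ ses z2 (q \o p)%VF, ses j w, forall x, z2 (j x) = z x
      & forall x, i (w x) = p (z2 x)].
Proof.
move=> S Sz; have [Hi Hq Ii Sq Ei] := S; have [Hz Hp Iz Sp Ez] := Sz.
have [||Z2 [z2 S2]] := @ker_ses _ _ _ _ (q \o p)%VF.
- exact: hom_comp.
- move=> y; have [m <-] := Sq y; have [x <-] := Sp m.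
  by exists x; rewrite comp_lfunE.
have [Hz2 Hqp Iz2 Sqp Ez2] := S2.
have [|j Hj Ej] := @factor_inj _ _ _ _ _ z2 z Hz2 Hz Iz2.
  by move=> x; apply/Ez2; rewrite comp_lfunE (ses_pk Sz) linear0.
have [||w Hw Ew] := @factor_inj _ _ _ _ _ i (p \o z2)%VF Hi _ Ii.
- exact: hom_comp.
- by move=> x; apply/Ei; have := ses_pk S2 x; rewrite !comp_lfunE.
have {}Ew x : i (w x) = p (z2 x) by rewrite Ew comp_lfunE.
exists Z2, z2, j, w; split=> //; split=> //.
- by move=> x y E; apply: Iz; rewrite -!Ej E.
- move=> y; have [x Ex] := Sp (i y).
  have /Ez2[u Eu] : (q \o p)%VF x = 0 by rewrite comp_lfunE Ex (ses_pk S).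
  by exists u; apply: Ii; rewrite Ew -Eu.
- move=> x; split=> [E|[l ->]]; last first.
    by apply: Ii; rewrite Ew Ej (ses_pk Sz) linear0.
  have /Ez[l El] : p (z2 x) = 0 by rewrite -Ew E linear0.
  by exists l; apply: Iz2; rewrite Ej.
Qed.

Lemma ext_vanish_quotient0 M1 M M2 N (i : 'Hom(M1, M)) (q : 'Hom(M, M2)) :
    ses i q -> ext_vanish 0 M N ->
    (forall phi : 'Hom(M1, N), mod_hom phi ->
     exists2 psi : 'Hom(M, N), mod_hom psi & forall x, psi (i x) = phi x) ->
  ext_vanish 0 M2 N.
Proof.
move=> S E H; have [Q [Z [z [p [HQ Sz]]]]] := proj_cover M.
have [Z2 [z2 [j [w [S2 Sj Ej Ew]]]]] := cover_rotation S Sz.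
have [Hz2 _ Iz2 _ _] := S2; have [Hj Hw _ Sw Ejw] := Sj; have [_ Hp _ _ _] := Sz.
apply: (ext_vanish0 HQ S2) => phi Hphi.
have [psi Hpsi Epsi] := E _ _ _ _ HQ Sz _ (hom_comp Hphi Hj).
(* The difference kills [Z], so it descends to [M1] and extends to [M]. *)
have HD : mod_hom (phi - (psi \o z2))%VF.
  by apply: hom_sub => //; apply: hom_comp.
have [|chi Hchi Echi] := factor_surj Hw HD Sw.
  move=> m /Ejw[l ->]; rewrite !lfun_simpl Ej Epsi comp_lfunE.
  by rewrite subrr.
have [rho Hrho Erho] := H _ Hchi.
exists (psi + (rho \o p))%VF; first by apply: hom_add => //; apply: hom_comp.
move=> x; rewrite !lfun_simpl -Ew Erho Echi !lfun_simpl.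
by rewrite addrC subrK.
Qed.

(** Both halves are proved together: in the rotated sequence [Z -> Z2 -> M1]
    the second half in degree [i] gives the first one in degree [i + 1], while
    rotating twice turns the first half in degree [i] into the second one in
    degree [i + 1]. *)
Lemma ext_vanish_ses i : 
  (forall M1 M M2 N (f : 'Hom(M1, M)) (q : 'Hom(M, M2)), ses f q ->
     ext_vanish i M1 N -> ext_vanish i M2 N -> ext_vanish i M N) /\
  (forall M1 M M2 N (f : 'Hom(M1, M)) (q : 'Hom(M, M2)), ses f q ->
     ext_vanish i M N -> ext_vanish i.+1 M2 N -> ext_vanish i M1 N).
Proof.
elim: i => [|i [IHmid IHsub]].
  split=> M1 M M2 N f q S E1 E2;
    have [Q [Z [z [p [HQ Sz]]]]] := proj_cover M;
    have [Z2 [z2 [j [w [S2 Sj Ej Ew]]]]] := cover_rotation S Sz.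
    apply: (ext_vanish0 HQ Sz) => phi Hphi.
    have [psi Hpsi Epsi] := ext_vanish_extend E1 Sj Hphi.
    have [chi Hchi Echi] := ext_vanish_extend E2 S2 Hpsi.
    by exists chi => // x; rewrite -Ej Echi Epsi.
  have {}E2 : ext_vanish 0 Z2 N := E2 _ _ _ _ HQ S2.
  apply: (ext_vanish_quotient0 Sj E2) => phi Hphi.
  have [psi Hpsi Epsi] := E1 _ _ _ _ HQ Sz _ Hphi.
  exists (psi \o z2)%VF; first by apply: hom_comp => //; case: S2.
  by move=> x; rewrite comp_lfunE Ej Epsi.
split=> M1 M M2 N f q S E1 E2.
all: have [Q [Z [z [p [HQ Sz]]]]] := proj_cover M.
all: have [Z2 [z2 [j [w [S2 Sj Ej Ew]]]]] := cover_rotation S Sz.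
  apply: (ext_vanish_syzygy HQ Sz).
  by apply: (IHsub _ _ _ _ _ _ Sj); [apply: E2 HQ S2 | ].
have EZ : ext_vanish i Z N := E1 _ _ _ _ HQ Sz.
have EZ2 : ext_vanish i.+1 Z2 N := E2 _ _ _ _ HQ S2.
have [Q' [Y [y [p' [HQ' Sy]]]]] := proj_cover Z2.
have [Y2 [y2 [j' [w' [S2' Sj' _ _]]]]] := cover_rotation Sj Sy.
apply: (ext_vanish_syzygy HQ' S2').
by apply: (IHmid _ _ _ _ _ _ Sj'); [apply: EZ2 HQ' Sy | ].
Qed.

Lemma ext_vanish_middle i M1 M M2 N (f : 'Hom(M1, M)) (q : 'Hom(M, M2)) :
  ses f q -> ext_vanish i M1 N -> ext_vanish i M2 N -> ext_vanish i M N.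
Proof. by case: (ext_vanish_ses i) => H _; apply: H. Qed.

Lemma ext_vanish_sub i M1 M M2 N (f : 'Hom(M1, M)) (q : 'Hom(M, M2)) :
  ses f q -> ext_vanish i M N -> ext_vanish i.+1 M2 N -> ext_vanish i M1 N.
Proof. by case: (ext_vanish_ses i) => _ H; apply: H. Qed.

Lemma ext_vanish_quotient i M1 M M2 N (f : 'Hom(M1, M)) (q : 'Hom(M, M2)) :
  ses f q -> ext_vanish i M1 N -> ext_vanish i.+1 M N -> ext_vanish i.+1 M2 N.
Proof.
move=> S E1 E2.
have [Q [Z [z [p [HQ Sz]]]]] := proj_cover M.
have [Z2 [z2 [j [w [S2 Sj Ej Ew]]]]] := cover_rotation S Sz.
apply: (ext_vanish_syzygy HQ S2).
by apply: (ext_vanish_middle Sj); [apply: E2 HQ Sz | ].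
Qed.

Lemma ext_vanish_dsum_l i M1 M2 N :
  ext_vanish i M1 N -> ext_vanish i M2 N -> ext_vanish i (dsum M1 M2) N.
Proof.
have [f Hf Ef] := hom_pair (@hom_id _ _ M1) (@hom_0 _ _ M1 M2).
have [q Hq Eq] := hom_copair (@hom_0 _ _ M1 M2) (@hom_id _ _ M2).
have S : ses f q.
  split=> //.
  - by move=> x y; rewrite !Ef !lfun_simpl => -[].
  - by move=> y; exists (0, y); rewrite Eq !lfun_simpl add0r.
  - move=> [x y]; rewrite Eq !lfun_simpl add0r /=; split=> [->|[l]].
      by exists x; rewrite Ef !lfun_simpl.
    by rewrite Ef !lfun_simpl => -[].
exact: ext_vanish_middle S.
Qed.

End Ext.

(** * Projective resolutions *)

Section Resolutions.

Variables (K : fieldType) (A : falgType K).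
Implicit Types M N L P Q X Y Z : rmod A.

Lemma exact_lfun (U V W : vectType K) (f : 'Hom(U, V)) (g : 'Hom(V, W)) :
  limg f = lker g <-> forall x, g x = 0 <-> exists u, x = f u.
Proof.
split=> [E x|H].
  split=> [E0|[u ->]]; last first.
    by apply/eqP; rewrite -memv_ker -E memv_img ?memvf.
  have : x \in limg f by rewrite E memv_ker E0.
  by case/memv_imgP=> u _ ->; exists u.
apply/vspaceP=> x; rewrite memv_ker; apply/idP/eqP=> [/memv_imgP[u _ ->]|].
  by apply/H; exists u.
by case/H=> u ->; apply: memv_img; apply: memvf.
Qed.

(** The beginning of a resolution is a projective cover together with a
    surjection of the next term onto its kernel. *)
Lemma resolution_ses M (R : proj_resolution M) :
  exists (L : rmod A) (k : 'Hom(L, res_obj R 0)) (d : 'Hom(res_obj R 1, L)),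
    [/\ ses k (res_aug R), mod_hom d, surj d
      & forall x, k (d x) = res_diff R 0 x].
Proof.
have Sp := (limg_surj (res_aug R)).1 (res_aug_surj R).
have Hd := (exact_lfun (res_diff R 0) (res_aug R)).1 (res_exact0 R).
have [L [k S]] := ker_ses (res_aug_hom (p := R)) Sp.
have [Hk _ Ik _ Ek] := S.
have [|d Hd' Ed] := factor_inj Hk (res_diff_hom (p := R) (i := 0)) Ik.
  by move=> x; apply/Ek/Hd; exists x.
exists L, k, d; split=> // y.
have /Hd[x Ex] : res_aug R (k y) = 0 by rewrite (ses_pk S).
by exists x; apply: Ik; rewrite Ed.
Qed.

Lemma shift_aug_surj M L (R : proj_resolution M) (d : 'Hom(res_obj R 1, L)) :
  surj d -> limg d = fullv.
Proof. by move/limg_surj. Qed.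

Lemma shift_exact0 M L (R : proj_resolution M) (k : 'Hom(L, res_obj R 0))
    (d : 'Hom(res_obj R 1, L)) :
    injective k -> (forall x, k (d x) = res_diff R 0 x) ->
  limg (res_diff R 1) = lker d.
Proof.
move=> Ik E; rewrite res_exactS; apply/vspaceP=> x; rewrite !memv_ker -E.
by rewrite -(inj_eq Ik) linear0.
Qed.

Definition shift_resolution M L (R : proj_resolution M)
    (k : 'Hom(L, res_obj R 0)) (d : 'Hom(res_obj R 1, L)) (Hd : mod_hom d)
    (Sd : surj d) (Ik : injective k)
    (E : forall x, k (d x) = res_diff R 0 x) : proj_resolution L :=
  @ProjResolution K A L (fun i => res_obj R i.+1) (fun i => res_diff R i.+1) d
    (fun i => @res_proj _ _ _ R i.+1)
    (fun i => res_diff_hom (p := R) (i := i.+1)) Hd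
    (shift_aug_surj Sd) (shift_exact0 Ik E) (fun i => res_exactS R i.+1).

(** Shifting a resolution of [M] by one step resolves the syzygy of [M] and
    leaves cocycles and coboundaries unchanged, so only Ext^1 needs an
    argument. *)
Lemma ext_vanish_resolution i M N (R : proj_resolution M) :
  (forall phi : 'Hom(res_obj R i.+1, N), cocycle phi -> coboundary phi) <->
  ext_vanish i M N.
Proof.
elim: i M R => [|i IH] M R.
all: have [L [k [d [S Hd Sd E]]]] := resolution_ses R;
  have [Hk Hp Ik Sp Ek] := S.
- have Ed := (exact_lfun _ _).1 (res_exactS R 0).
  split=> H.
    apply: (ext_vanish0 (@res_proj _ _ _ R 0) S) => phi Hphi.
    have [|psi [Hpsi Epsi]] := H (phi \o d)%VF.
      split; first exact: hom_comp.
      apply/lfunP=> x; rewrite !lfun_simpl.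
      suff -> : d (res_diff R 1 x) = 0 by rewrite linear0.
      by apply: Ik; rewrite E linear0; apply/Ed; exists x.
    exists psi => // x; have [y <-] := Sd x.
    by rewrite E -[RHS]comp_lfunE Epsi comp_lfunE.
  move=> phi [Hphi Ephi].
  have [x|phi' Hphi' Ephi'] := factor_surj Hd Hphi Sd.
    move=> dx0; have /Ed[u ->] : res_diff R 0 x = 0 by rewrite -E dx0 linear0.
    by rewrite -comp_lfunE Ephi zero_lfunE.
  have [psi Hpsi Epsi] := H _ _ _ _ (@res_proj _ _ _ R 0) S _ Hphi'.
  exists psi; split=> //; apply/lfunP=> x.
  by rewrite comp_lfunE -E Epsi Ephi'.
- have := IH _ (shift_resolution Hd Sd Ik E) => /= {}IH.
  split=> [/IH|H]; first exact: (ext_vanish_syzygy (@res_proj _ _ _ R 0) S).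
  exact/IH/(H _ _ _ _ (@res_proj _ _ _ R 0) S).
Qed.

Lemma ext_vanish_Ext_eq0 i M N : ext_vanish i M N -> Ext_eq0 i.+1 M N.
Proof. by move=> H R; apply/ext_vanish_resolution. Qed.

Lemma pd_le_ext_vanish m M N : pd_le m M -> ext_vanish m M N.
Proof.
move=> [R HR]; apply/(@ext_vanish_resolution m M N R) => phi _.
exists 0; split; first exact: hom_0.
have /zero_modP H : zero_mod (res_obj R m.+1) by apply: HR.
by apply/lfunP=> x; rewrite (H x) !linear0.
Qed.

(** The vanishing of Ext^1(M, L) for a syzygy [L] of [M] retracts the cover onto
    [L], so it splits. *)
Lemma ext_vanish_projectiveP M :
  (forall N, ext_vanish 0 M N) -> projective M.
Proof.
move=> H; have [Q [L [k [p [HQ S]]]]] := proj_cover M.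
have [Hk Hp Ik Sp Ek] := S.
have [r Hr Er] := H _ _ _ _ _ HQ S _ (@hom_id _ _ L).
have Hd : mod_hom (\1 - (k \o r))%VF.
  by apply: hom_sub; [apply: hom_id | apply: hom_comp].
have [|s Hs Es] := factor_surj Hp Hd Sp.
  by move=> _ /Ek[l ->]; rewrite !lfun_simpl Er id_lfunE subrr.
apply: (projective_retract Hs Hp _ HQ) => y.
have [x <-] := Sp y; rewrite Es !lfun_simpl linearB /= (ses_pk S).
by rewrite subr0.
Qed.

Lemma zero_mod_free0 : zero_mod (free_mod A 0).
Proof. by apply/zero_modP=> x; apply/ffunP; case. Qed.

Lemma pd_le0 M : projective M -> pd_le 0 M.
Proof.
move=> HM; (* [M] itself, followed by the zero module [free_mod A 0]. *)
pose O i := if i is 0%N then M else free_mod A 0.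
have H0 i : zero_mod (O i.+1) := zero_mod_free0.
have HO i : projective (O i) by case: i => // i; apply: free_projective.
have Ex0 : limg (0 : 'Hom(O 1%N, O 0%N)) = lker (\1%VF : 'Hom(M, M)).
  apply/exact_lfun => x; rewrite id_lfunE; split=> [->|[u ->]].
    by exists 0; rewrite linear0.
  by rewrite zero_lfunE.
have ExS i : limg (0 : 'Hom(O i.+2, O i.+1)) = lker (0 : 'Hom(O i.+1, O i)).
  apply/exact_lfun => x; rewrite zero_lfunE; split=> // _.
  by exists 0; rewrite linear0; exact: (zero_modP (O i.+1)).1 (H0 i) x.
have Sid : limg (\1%VF : 'Hom(M, M)) = fullv by rewrite lim1g.
exists (@ProjResolution K A M O (fun i => 0) \1%VF HO (fun i => @hom_0 _ _ _ _)
  (@hom_id _ _ M) Sid Ex0 ExS).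
by case.
Qed.

Lemma pd_leS m L Q M (k : 'Hom(L, Q)) (p : 'Hom(Q, M)) :
  projective Q -> ses k p -> pd_le m L -> pd_le m.+1 M.
Proof.
move=> HQ S [R HR]; have [Hk Hp Ik Sp Ek] := S.
pose O i := if i is j.+1 then res_obj R j else Q.
pose D i : 'Hom(O i.+1, O i) :=
  match i with 0%N => (k \o res_aug R)%VF | j.+1 => res_diff R j end.
have HO i : projective (O i) by case: i => //= i; apply: res_proj.
have HD i : mod_hom (D i).
  case: i => [|i]; last exact: res_diff_hom.
  by apply: hom_comp => //; apply: res_aug_hom.
have Sa := (limg_surj _).1 (res_aug_surj R).
have Ex0 : limg (D 0%N) = lker p.
  apply/exact_lfun => x; split=> [/Ek[l ->]|[u ->]].
    by have [y <-] := Sa l; exists y; rewrite comp_lfunE.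
  by rewrite comp_lfunE (ses_pk S).
have ExS i : limg (D i.+1) = lker (D i).
  case: i => [|i] /=; last exact: res_exactS.
  rewrite res_exact0; apply/vspaceP=> x; rewrite !memv_ker comp_lfunE.
  by rewrite -(inj_eq Ik) linear0.
exists (@ProjResolution K A M O D p HO HD Hp ((limg_surj _).2 Sp) Ex0 ExS).
by case=> // i; rewrite ltnS => /HR.
Qed.

(** Projective dimension at most [m] is the vanishing of Ext^(m+1), whence the
    comparison of global dimensions reduces to that of Ext. *)
Lemma pd_leP m M : pd_le m M <-> forall N, ext_vanish m M N.
Proof.
split=> [H N|]; first exact: pd_le_ext_vanish.
elim: m M => [|m IH] M H; first exact/pd_le0/ext_vanish_projectiveP.
have [Q [L [k [p [HQ S]]]]] := proj_cover M.
by apply: (pd_leS HQ S); apply: IH => N; apply: H HQ S.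
Qed.

Lemma ext_vanishW m M : (forall N, ext_vanish m M N) ->
  forall i N, (m <= i)%N -> ext_vanish i M N.
Proof.
elim: m M => [|m IH] M H i N.
  by move=> _; apply/ext_vanish_projective/ext_vanish_projectiveP.
have [Q [L [k [p [HQ S]]]]] := proj_cover M.
case: i => // i; rewrite ltnS => Hi; apply: (ext_vanish_syzygy HQ S).
by apply: IH Hi => N'; apply: H HQ S.
Qed.

(** [Ext_eq0] quantifies over all resolutions; the bound on the projective
    dimension supplies one. *)
Lemma Ext_eq0_ext_vanish i m M N : pd_le m M ->
  Ext_eq0 i.+1 M N <-> ext_vanish i M N.
Proof.
move=> [R _]; split=> [H|]; last exact: ext_vanish_Ext_eq0.
by apply/(@ext_vanish_resolution i M N R); apply: H.
Qed.

End Resolutions.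

(** * Isomorphisms and direct decompositions *)

Section Isomorphisms.

Variables (K : fieldType) (A : falgType K).
Implicit Types M N X Y : rmod A.

Lemma isomorphicP M N :
  isomorphic M N <-> exists (f : 'Hom(M, N)) (g : 'Hom(N, M)),
    [/\ mod_hom f, mod_hom g, forall x, g (f x) = x & forall y, f (g y) = y].
Proof.
split=> [[f [Hf bf]]|[f [g [Hf Hg gf fg]]]]; last first.
  by exists f; split=> //; exists g.
have If := bij_inj bf; have Sf : surj f.
  by case: bf => h _ fh y; exists (h y).
exists f, (f^-1)%VF; split=> //; last exact: lfun_rinv.
  move=> v a; apply: If.
  by rewrite lfun_rinv // Hf lfun_rinv.
exact: lfun_linv.
Qed.

Lemma isomorphic_refl M : isomorphic M M.
Proof.
by apply/isomorphicP; exists \1%VF, \1%VF; split; try exact: hom_id;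
  move=> x; rewrite !id_lfunE.
Qed.

Lemma isomorphic_sym M N : isomorphic M N -> isomorphic N M.
Proof.
by case/isomorphicP=> f [g [Hf Hg gf fg]]; apply/isomorphicP; exists g, f.
Qed.

Lemma isomorphic_trans M N X :
  isomorphic M N -> isomorphic N X -> isomorphic M X.
Proof.
case/isomorphicP=> f [g [Hf Hg gf fg]] /isomorphicP[f' [g' [Hf' Hg' gf' fg']]].
apply/isomorphicP; exists (f' \o f)%VF, (g \o g')%VF.
by split; try exact: hom_comp; move=> x; rewrite !comp_lfunE ?gf' ?fg ?gf ?fg'.
Qed.

Definition biproduct M X Y (i : 'Hom(X, M)) (p : 'Hom(M, X))
    (j : 'Hom(Y, M)) (q : 'Hom(M, Y)) : Prop :=
  [/\ mod_hom i, mod_hom p, mod_hom j, mod_hom q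
    & [/\ forall x, p (i x) = x, forall y, q (j y) = y
        , forall x, q (i x) = 0, forall y, p (j y) = 0
        & forall m, i (p m) + j (q m) = m]].

Lemma biproduct_iso M X Y (i : 'Hom(X, M)) (p : 'Hom(M, X))
    (j : 'Hom(Y, M)) (q : 'Hom(M, Y)) :
  biproduct i p j q -> isomorphic M (dsum X Y).
Proof.
move=> [Hi Hp Hj Hq [pi qj qi pj E]]; apply/isomorphicP.
have [f Hf Ef] := hom_pair Hp Hq; have [g Hg Eg] := hom_copair Hi Hj.
exists f, g; split=> // [m|[x y]]; first by rewrite Ef Eg E.
by rewrite Eg Ef /= !linearD /= pi pj qi qj addr0 add0r.
Qed.

Lemma dsum_biproduct X Y :
  exists (i : 'Hom(X, dsum X Y)) p (j : 'Hom(Y, dsum X Y)) q,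
    biproduct i p j q.
Proof.
have [i Hi Ei] := hom_pair (@hom_id _ _ X) (@hom_0 _ _ X Y).
have [j Hj Ej] := hom_pair (@hom_0 _ _ Y X) (@hom_id _ _ Y).
have [p Hp Ep] := hom_copair (@hom_id _ _ X) (@hom_0 _ _ Y X).
have [q Hq Eq] := hom_copair (@hom_0 _ _ X Y) (@hom_id _ _ Y).
exists i, p, j, q; split=> //.
split; last first.
  case=> x y; rewrite Ei Ej Ep Eq !lfun_simpl /= addr0 add0r.
  by congr (_, _); rewrite ?addr0 ?add0r.
all: by move=> x; rewrite ?Ep ?Eq ?Ei ?Ej !lfun_simpl /= ?addr0 ?add0r.
Qed.

Lemma iso_biproduct M X Y : isomorphic M (dsum X Y) ->
  exists (i : 'Hom(X, M)) p (j : 'Hom(Y, M)) q, biproduct i p j q.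
Proof.
case/isomorphicP=> f [g [Hf Hg gf fg]].
have [i [p [j [q [Hi Hp Hj Hq [pi qj qi pj E]]]]]] := dsum_biproduct X Y.
exists (g \o i)%VF, (p \o f)%VF, (g \o j)%VF, (q \o f)%VF.
split; try exact: hom_comp.
split=> x; rewrite !comp_lfunE ?fg //.
by rewrite -linearD /= E gf.
Qed.

Lemma split_idempotent M (p : 'Hom(M, M)) :
    mod_hom p -> (forall x, p (p x) = p x) ->
  exists X Y (i : 'Hom(X, M)) (P : 'Hom(M, X)) (j : 'Hom(Y, M)) Q,
    biproduct i P j Q /\ forall x, i (P x) = p x.
Proof.
move=> Hp pp.
pose i := sub_incl (limg_submod Hp); pose j := sub_incl (lker_submod Hp).
have Hi : mod_hom i := @hom_sub_incl _ _ _ _ _.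
have Hj : mod_hom j := @hom_sub_incl _ _ _ _ _.
have Ii : injective i := @sub_incl_inj _ _ _ _ _.
have Ij : injective j := @sub_incl_inj _ _ _ _ _.
have piE x : p (i x) = i x.
  have : i x \in limg p by apply/(mem_sub_incl (limg_submod Hp)); exists x.
  by case/memv_imgP=> m _ ->; rewrite pp.
have pj y : p (j y) = 0.
  apply/eqP; rewrite -memv_ker.
  by apply/(mem_sub_incl (lker_submod Hp)); exists y.
have [m|P HP EP] := @factor_inj _ _ _ _ _ i p Hi Hp Ii.
  by apply/(mem_sub_incl (limg_submod Hp)); apply: memv_img; apply: memvf.
have Hd : mod_hom (\1 - p)%VF by apply: hom_sub => //; apply: hom_id.
have [m|Q HQ EQ] := @factor_inj _ _ _ _ _ j _ Hj Hd Ij.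
  apply/(mem_sub_incl (lker_submod Hp)).
  by rewrite memv_ker !lfun_simpl linearB /= pp subrr.
exists _, _, i, P, j, Q; split=> //; split=> //; split=> x.
- by apply: Ii; rewrite EP.
- by apply: Ij; rewrite EQ !lfun_simpl pj subr0.
- by apply: Ij; rewrite EQ !lfun_simpl piE subrr linear0.
- by apply: Ii; rewrite EP pj linear0.
- by rewrite EP EQ !lfun_simpl addrC subrK.
Qed.

(** An idempotent endomorphism splits the module into its image and its
    kernel. *)
Lemma indecomposable_idempotent M (p : 'Hom(M, M)) :
    indecomposable M -> mod_hom p -> (forall x, p (p x) = p x) ->
  (forall x, p x = 0) \/ (forall x, p x = x).
Proof.
move=> [_ HM] Hp pp.
have [X [Y [i [P [j [Q [S iP]]]]]]] := split_idempotent Hp pp.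
have [_ _ _ _ [_ _ _ _ E]] := S.
have [/zero_modP Z|/zero_modP Z] := HM _ _ (biproduct_iso S).
  by left=> x; rewrite -iP (Z (P x)) linear0.
by right=> x; rewrite -iP -[RHS]E (Z (Q x)) linear0 addr0.
Qed.

Lemma dsum_isomorphic X X' Y Y' :
  isomorphic X X' -> isomorphic Y Y' -> isomorphic (dsum X Y) (dsum X' Y').
Proof.
case/isomorphicP=> f [g [Hf Hg gf fg]] /isomorphicP[f' [g' [Hf' Hg' gf' fg']]].
have [i [p [j [q [Hi Hp Hj Hq [pi qj qi pj E]]]]]] := dsum_biproduct X Y.
apply: (@biproduct_iso (dsum X Y) X' Y' (i \o g)%VF (f \o p)%VF
  (j \o g')%VF (f' \o q)%VF).
split; try exact: hom_comp.
split=> x; rewrite !comp_lfunE ?pi ?qj ?qi ?pj ?fg ?fg' ?linear0 //.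
by rewrite gf gf' E.
Qed.

Lemma zero_mod_iso M N : isomorphic M N -> zero_mod M -> zero_mod N.
Proof.
case/isomorphicP=> f [g [_ _ _ fg]] /zero_modP Z; apply/zero_modP=> y.
by rewrite -[y]fg (Z (g y)) linear0.
Qed.

Lemma indecomposable_iso M N :
  isomorphic M N -> indecomposable M -> indecomposable N.
Proof.
move=> I [NZ H]; split=> [Z|X Y I'].
  by apply: NZ; apply: zero_mod_iso Z; apply: isomorphic_sym.
exact/H/(isomorphic_trans I).
Qed.

Lemma ext_vanish_iso i M M' N N' : isomorphic M M' -> isomorphic N N' ->
  ext_vanish i M N -> ext_vanish i M' N'.
Proof.
case/isomorphicP=> f [g [Hf Hg gf fg]] /isomorphicP[f' [g' [Hf' Hg' gf' fg']]].
move=> E; apply: (ext_vanish_retract Hg Hf fg).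
exact: (ext_vanish_retract_r Hg' Hf' fg').
Qed.

End Isomorphisms.

(** * Modules with a scalar action *)

Section ScalarModule.

Variables (K : fieldType) (A : falgType K) (chi : {lrmorphism A -> K^o}).
Variable V : vectType K.

Definition scal_act (v : V) (a : A) : V := (chi a : K) *: v.

Fact scal_act_linearl a : linear (scal_act^~ a).
Proof.
by move=> k u v; rewrite /scal_act scalerDr !scalerA [_ * k]mulrC.
Qed.

Fact scal_act_linearr v : linear (scal_act v).
Proof.
by move=> k a b; rewrite /scal_act linearP /= scalerDl -scalerA.
Qed.

Fact scal_act1 v : scal_act v 1 = v.
Proof. by rewrite /scal_act rmorph1 scale1r. Qed.

Fact scal_actM v a b : scal_act v (a * b) = scal_act (scal_act v a) b.
Proof. by rewrite /scal_act rmorphM /= scalerA [chi b * _]mulrC. Qed.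

(** A sum of copies of the one-dimensional module given by [chi], as many as the
    dimension of [V]. *)
Definition scal_mod : rmod A :=
  RMod scal_act_linearl scal_act_linearr scal_act1 scal_actM.

(** Take any linear lift and multiply it by [e]: on [M e] the algebra acts
    through [chi], which makes the result equivariant. *)
Lemma scal_projective (e : A) :
  chi e = 1 -> (forall a, e * a = (chi a : K) *: e) -> projective scal_mod.
Proof.
move=> chie He; apply: projectiveP => M N g h Hg Hh Sg.
pose k0 : 'Hom(V, M) := (g^-1 \o h)%VF.
have L : linear ((fun v : V => ract (k0 v) e) : scal_mod -> M).
  by move=> c u v; rewrite linearP /= ractDl ractZl.
have [k Ek] := lfun_linear L; exists k => v.
  by move=> a; rewrite !Ek -ractM He ractZr linearZ /= ractZl.
by rewrite Ek Hg comp_lfunE lfun_rinv // -Hh /= /scal_act chie scale1r.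
Qed.

(** Dually, extend linearly and evaluate the extension at [v e]. *)
Lemma scal_injective (e : A) :
  chi e = 1 -> (forall a, a * e = (chi a : K) *: e) -> injective_mod scal_mod.
Proof.
move=> chie He M N g h Hg Hh /eqP/lker0P Ig.
pose k0 : 'Hom(N, V) := (h \o g^-1)%VF.
have L : linear ((fun v : N => k0 (ract v e)) : N -> scal_mod).
  by move=> c u v; rewrite ractDl ractZl linearP.
have [k Ek] := lfun_linear L; exists k; split.
  by move=> v a; rewrite !Ek -ractM He ractZr linearZ.
apply/lfunP=> v; rewrite comp_lfunE Ek -Hg comp_lfunE lfun_linv //.
by rewrite Hh /= /scal_act chie scale1r.
Qed.

End ScalarModule.

(** * Restriction of scalars *)

Section Restriction.

Variables (K : fieldType) (R S : falgType K) (pi : {lrmorphism R -> S}).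
Implicit Types M N X Y : rmod S.

Section Module.

Variable M : rmod S.

Definition res_act (v : M) (a : R) : M := ract v (pi a).

Fact res_act_linearl a : linear (res_act^~ a).
Proof. exact: ract_linearl. Qed.

Fact res_act_linearr v : linear (res_act v).
Proof. by move=> k a b; rewrite /res_act !linearP. Qed.

Fact res_act1 v : res_act v 1 = v.
Proof. by rewrite /res_act rmorph1 ract1. Qed.

Fact res_actM v a b : res_act v (a * b) = res_act (res_act v a) b.
Proof. by rewrite /res_act rmorphM ractM. Qed.

Definition res_mod : rmod R :=
  RMod res_act_linearl res_act_linearr res_act1 res_actM.

End Module.

Lemma hom_res M N (f : 'Hom(M, N)) :
  mod_hom f -> @mod_hom _ _ (res_mod M) (res_mod N) f.
Proof. by move=> Hf v a; apply: Hf. Qed.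

Lemma res_isomorphic M N : isomorphic M N -> isomorphic (res_mod M) (res_mod N).
Proof. by case=> f [Hf bf]; exists f; split=> //; apply: hom_res. Qed.

Lemma res_dsum X Y :
  isomorphic (res_mod (dsum X Y)) (dsum (res_mod X) (res_mod Y)).
Proof.
have [i [p [j [q [Hi Hp Hj Hq E]]]]] := dsum_biproduct X Y.
by apply: (@biproduct_iso _ _ (res_mod (dsum X Y)) (res_mod X) (res_mod Y)
  i p j q); split=> //; apply: hom_res.
Qed.

Lemma ses_res X Y M (k : 'Hom(X, Y)) (p : 'Hom(Y, M)) :
  ses k p -> @ses _ _ (res_mod X) (res_mod Y) (res_mod M) k p.
Proof. by case=> Hk Hp Ik Sp Ek; split=> //; apply: hom_res. Qed.

Hypothesis pi_surj : surj pi.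

Lemma hom_res_inv M N (f : 'Hom(M, N)) :
  @mod_hom _ _ (res_mod M) (res_mod N) f -> mod_hom f.
Proof. by move=> Hf v a; have [b <-] := pi_surj a; apply: Hf. Qed.

Lemma isomorphic_res_inv M N :
  isomorphic (res_mod M) (res_mod N) -> isomorphic M N.
Proof. by case=> f [Hf bf]; exists f; split=> //; apply: hom_res_inv. Qed.

Lemma indecomposable_res_inv M : indecomposable (res_mod M) -> indecomposable M.
Proof.
case=> NZ H; split=> // X Y /res_isomorphic I.
exact/(H (res_mod X) (res_mod Y))/(isomorphic_trans I)/res_dsum.
Qed.

(** Dimension shifting over [S] computes Ext over [R] as long as the free
    [S]-modules contribute nothing.  The module [N] need not come from [S]: it
    suffices that maps into it from restricted modules extend whenever maps
    into the [S]-module [N'] do. *)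
Lemma ext_vanish_res n (N : rmod R) N' :
    (forall m j, (j < n)%N -> ext_vanish j (res_mod (free_mod S m)) N) ->
    (forall (X Q : rmod S) (k : 'Hom(X, Q)),
      (forall phi : 'Hom(X, N'), mod_hom phi ->
        exists2 psi : 'Hom(Q, N'), mod_hom psi & forall x, psi (k x) = phi x) ->
      forall phi : 'Hom(res_mod X, N), mod_hom phi ->
        exists2 psi : 'Hom(res_mod Q, N),
          mod_hom psi & forall x, psi (k x) = phi x) ->
  forall i X, (i < n)%N -> ext_vanish i X N' -> ext_vanish i (res_mod X) N.
Proof.
move=> HF HN i X; elim: i X => [|i IH] X Hi E.
all: have [m [p [Hp Sp]]] := free_cover X; have [L [k Sk]] := ker_ses Hp Sp.
  apply: (ext_vanish_quotient0 (ses_res Sk)); first exact: HF.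
  exact/HN/(E _ _ _ _ (@free_projective _ _ m) Sk).
apply: (ext_vanish_quotient (ses_res Sk)); last exact: HF.
apply: IH; first exact: ltnW.
exact: E (@free_projective _ _ m) Sk.
Qed.

(** Conversely, the long exact sequence passes the vanishing from [X] down to a
    syzygy over [S]; in the lowest degree an extension over [R] is already
    [S]-linear. *)
Lemma ext_vanish_res_inv N :
    (forall m j, ext_vanish j (res_mod (free_mod S m)) (res_mod N)) ->
  forall i X, ext_vanish i (res_mod X) (res_mod N) -> ext_vanish i X N.
Proof.
move=> HF i X; elim: i X => [|i IH] X E.
all: have [m [p [Hp Sp]]] := free_cover X; have [L [k Sk]] := ker_ses Hp Sp.
  apply: (ext_vanish0 (@free_projective _ _ m) Sk) => phi /hom_res Hphi.
  have [psi Hpsi Epsi] := ext_vanish_extend E (ses_res Sk) Hphi.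
  by exists psi => //; apply: hom_res_inv.
apply: (ext_vanish_syzygy (@free_projective _ _ m) Sk); apply: IH.
exact: (ext_vanish_sub (ses_res Sk)).
Qed.

Lemma ext_vanish_res_same N :
    (forall m j, ext_vanish j (res_mod (free_mod S m)) (res_mod N)) ->
  forall i X, ext_vanish i (res_mod X) (res_mod N) <-> ext_vanish i X N.
Proof.
move=> HF i X; split; first exact: ext_vanish_res_inv.
apply: (@ext_vanish_res i.+1) => // Y Q k H phi /hom_res_inv Hphi.
by have [psi Hpsi E] := H _ Hphi; exists psi => //; apply: hom_res.
Qed.

End Restriction.

(** * Descent along a corner *)

(** Along a multiplicative, not necessarily unital, map [iota : S -> R], a
    module on which [iota 1] acts as the identity becomes an [S]-module. *)
Section Descent.

Variables (K : fieldType) (R S : falgType K) (pi : {lrmorphism R -> S}).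
Variables (iota : {linear S -> R}) (chi : {lrmorphism S -> K^o}).
Hypothesis iotaM : forall a b, iota (a * b) = iota a * iota b.

Definition is_descendible (M : rmod R) : Prop := forall v : M, ract v (iota 1) = v.

Section Module.

Variable M : rmod R.

Definition descb : bool := linfun (ractl (iota 1)) == \1%VF :> 'End(M).

Lemma descP : reflect (is_descendible M) descb.
Proof.
apply: (iffP eqP) => [E v|H].
  by have /lfunP/(_ v) := E; rewrite lfunE id_lfunE.
by apply/lfunP=> v; rewrite lfunE id_lfunE /= /ractl H.
Qed.

(** The scalar action through [chi] is a default that makes descent a total
    operation with the same underlying space, so that a linear map between two
    modules is also a linear map between their descents, with no transport. *)
Definition desc_act (v : M) (a : S) : M :=
  if descb then ract v (iota a) else (chi a : K) *: v.

Fact desc_act_linearl a : linear (desc_act^~ a).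
Proof.
rewrite /desc_act; case: descb; last exact: (scal_act_linearl chi).
by move=> k u v; rewrite ractDl ractZl.
Qed.

Fact desc_act_linearr v : linear (desc_act v).
Proof.
rewrite /desc_act; case: descb; last exact: (scal_act_linearr chi v).
by move=> k a b; rewrite !linearP.
Qed.

Fact desc_act1 v : desc_act v 1 = v.
Proof.
rewrite /desc_act; case: descP => [-> //|_]; exact: (scal_act1 chi v).
Qed.

Fact desc_actM v a b : desc_act v (a * b) = desc_act (desc_act v a) b.
Proof.
rewrite /desc_act; case: descb; last exact: (scal_actM chi v).
by rewrite iotaM ractM.
Qed.

Definition desc_mod : rmod S :=
  RMod desc_act_linearl desc_act_linearr desc_act1 desc_actM.

End Module.

Hypothesis iota_pi : forall M, is_descendible M ->
  forall (v : M) a, ract v (iota (pi a)) = ract v a.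

Lemma res_descE M : is_descendible M -> forall (v : M) a,
  @ract _ _ (res_mod pi (desc_mod M)) v a = ract v a.
Proof.
by move=> HM v a; rewrite /= /res_act /= /desc_act; case: descP => // _;
  apply: iota_pi.
Qed.

Lemma hom_res_desc (M N : rmod R) (f : 'Hom(M, N)) :
    is_descendible M -> is_descendible N ->
  @mod_hom _ _ (res_mod pi (desc_mod M)) (res_mod pi (desc_mod N)) f <->
  mod_hom f.
Proof.
move=> HM HN; split=> Hf v a.
  have := Hf v a; rewrite (res_descE HM v a) => ->; exact: res_descE.
rewrite (res_descE HM v a) Hf; apply/esym; exact: res_descE.
Qed.

Lemma res_desc_iso M : is_descendible M -> isomorphic M (res_mod pi (desc_mod M)).
Proof.
move=> HM; apply/isomorphicP.
exists (\1%VF : 'End(M)), (\1%VF : 'End(M)); split.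
- by move=> v a; rewrite !id_lfunE res_descE.
- by move=> v a; rewrite !id_lfunE res_descE.
- by move=> v; rewrite !id_lfunE.
- by move=> v; rewrite !id_lfunE.
Qed.

(** The descended cycle consists of the same linear maps, which is what the
    default in [desc_act] is for. *)
Lemma directed_descent t (M : nat -> rmod R)
    (h : forall i, 'Hom(M i, M i.+1)) :
    surj pi -> representation_directed S -> (1 <= t)%N ->
    (forall i, (i <= t)%N -> indecomposable (M i)) ->
    (forall i, (i < t)%N -> [/\ mod_hom (h i), h i != 0 & ~ mod_iso (h i)]) ->
    (forall i, (i <= t)%N -> is_descendible (M i)) ->
  ~ isomorphic (M 0%N) (M t).
Proof.
move=> Spi dirS t0 indM Hh DM I.
apply: (dirS t (fun i => desc_mod (M i)) h t0) => [i Hi|i Hi|].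
- apply: (indecomposable_res_inv (pi := pi)).
  by apply: indecomposable_iso (indM i Hi); apply/res_desc_iso/DM.
- have [hom_h h0 h_iso] := Hh i Hi.
  have hom_hE := hom_res_desc (h i) (DM i (ltnW Hi)) (DM i.+1 Hi).
  split=> //; first exact/(hom_res_inv Spi)/hom_hE.
  by case=> hom_h' bij_h; apply: h_iso.
- apply: (isomorphic_res_inv Spi).
  apply: isomorphic_trans (isomorphic_trans I _).
    by apply/isomorphic_sym/res_desc_iso/DM.
  exact/res_desc_iso/DM.
Qed.

End Descent.

(** * Cluster tilting through the vanishing of Ext *)

Section ClusterTilting.

Variables (K : fieldType) (A : falgType K) (n d : nat) (C : rmod A -> Prop).
Hypothesis gdA : global_dimension_le A d.
Implicit Types M N X Y : rmod A.

(** Closure under isomorphisms, sums and summands follows from the second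
    orthogonality condition, because the vanishing of Ext is stable under
    them. *)
Lemma cluster_tiltingP : n_cluster_tilting n C <->
  (forall X, C X <-> forall i Y, (i.+1 < n)%N -> C Y -> ext_vanish i Y X) /\
  (forall X, C X <-> forall i Y, (i.+1 < n)%N -> C Y -> ext_vanish i X Y).
Proof.
have ExtE i M N : Ext_eq0 i.+1 M N <-> ext_vanish i M N.
  exact: (Ext_eq0_ext_vanish i N (gdA M)).
split=> [[_ _ _ C1 C2]|[C1 C2]].
  split=> X; [rewrite C1 | rewrite C2]; split=> H.
  - by move=> i Y Hi HY; apply/ExtE/H.
  - by move=> [|i] Y // Hi HY; apply/ExtE/H.
  - by move=> i Y Hi HY; apply/ExtE/H.
  - by move=> [|i] Y // Hi HY; apply/ExtE/H.
split.
- move=> X Y I /C2 HX; apply/C2 => i Z Hi HZ.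
  exact: (ext_vanish_iso I (isomorphic_refl Z)) (HX _ _ Hi HZ).
- move=> X Y /C2 HX /C2 HY; apply/C2 => i Z Hi HZ.
  by apply: ext_vanish_dsum_l; [apply: HX | apply: HY].
- move=> X Y /C2 HXY.
  have [i [p [j [q [Hi Hp Hj Hq [pi qj _ _ _]]]]]] := dsum_biproduct X Y.
  split; apply/C2 => m Z Hm HZ.
    exact: (ext_vanish_retract Hi Hp pi) (HXY _ _ Hm HZ).
  exact: (ext_vanish_retract Hj Hq qj) (HXY _ _ Hm HZ).
- move=> X; rewrite C1; split=> H.
    by move=> [|i] Y // Hi HY; apply/ExtE/H.
  by move=> i Y Hi HY; apply/ExtE/H.
- move=> X; rewrite C2; split=> H.
    by move=> [|i] Y // Hi HY; apply/ExtE/H.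
  by move=> i Y Hi HY; apply/ExtE/H.
Qed.

End ClusterTilting.

(** * The gluing and its projections *)

(** Locked, because unification would otherwise push a product in the gluing
    through the projections. *)
HB.lock Definition glueA (K : fieldType) (A B : falgType K)
  (f : {lrmorphism A -> K^o}) (g : {lrmorphism B -> K^o}) (x : gluing f g) : A :=
  (vsval x).1.
HB.lock Definition glueB (K : fieldType) (A B : falgType K)
  (f : {lrmorphism A -> K^o}) (g : {lrmorphism B -> K^o}) (x : gluing f g) : B :=
  (vsval x).2.

Section Projections.

Variables (K : fieldType) (A B : falgType K).
Variables (f : {lrmorphism A -> K^o}) (g : {lrmorphism B -> K^o}).

Local Notation G := (gluing f g).

Local Notation glueA := (@glueA K A B f g).
Local Notation glueB := (@glueB K A B f g).

Let glueE := (@glueA.unlock, @glueB.unlock).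

Fact glueA_linear : linear glueA.
Proof. by move=> k x y; rewrite !glueE linearP. Qed.
Fact glueB_linear : linear glueB.
Proof. by move=> k x y; rewrite !glueE linearP. Qed.

Fact glueA_monoid : monoid_morphism glueA.
Proof. by split; rewrite !glueE ?gluing_val1. Qed.
Fact glueB_monoid : monoid_morphism glueB.
Proof. by split; rewrite !glueE ?gluing_val1. Qed.

HB.instance Definition _ :=
  GRing.isLinear.Build K G A *:%R glueA glueA_linear.
HB.instance Definition _ :=
  GRing.isLinear.Build K G B *:%R glueB glueB_linear.
HB.instance Definition _ := GRing.isMonoidMorphism.Build G A glueA glueA_monoid.
HB.instance Definition _ := GRing.isMonoidMorphism.Build G B glueB glueB_monoid.

Lemma glue_ext (x y : G) : glueA x = glueA y -> glueB x = glueB y -> x = y.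
Proof.
rewrite !glueE => E1 E2; apply: val_inj => /=.
by rewrite [LHS]surjective_pairing E1 E2 -surjective_pairing.
Qed.

Lemma glue_compat (x : G) : f (glueA x) = g (glueB x).
Proof. by apply/eqP; rewrite !glueE -mem_gluing_space; apply: (subvsP x). Qed.

Definition glue (a : A) (b : B) : G := vsproj (gluing_space f g) (a, b).

Lemma glueK (a : A) (b : B) : f a = g b ->
  glueA (glue a b) = a /\ glueB (glue a b) = b.
Proof.
by move=> E; rewrite !glueE vsprojK // mem_gluing_space; apply/eqP.
Qed.

Lemma glue_linear k a b a' b' :
  glue (k *: a + a') (k *: b + b') = k *: glue a b + glue a' b'.
Proof. by rewrite /glue -linearP. Qed.

End Projections.

Arguments glueA {K A B f g} x.
Arguments glueB {K A B f g} x.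

(** * Corner idempotents of the gluing *)

Section Gluing.

Variables (K : fieldType) (A B : falgType K).
Variables (f : {lrmorphism A -> K^o}) (g : {lrmorphism B -> K^o}).
Variables (e : A) (eps : B).
Hypotheses (fe : f e = 1) (eE : forall a, e * a = (f a : K) *: e).
Hypotheses (geps : g eps = 1) (epsE : forall b, b * eps = (g b : K) *: eps).

Local Notation G := (gluing f g).
Implicit Types (M N L Q : rmod G) (X : rmod A) (Y : rmod B).
Local Notation resA := (res_mod (@glueA _ _ _ f g)).
Local Notation resB := (res_mod (@glueB _ _ _ f g)).

(** Multiplicative sections of the two projections.  They are not unital:
    [embA 1] is [(1, eps)] and [embB 1] is [(e, 1)]. *)
Definition embA (a : A) : G := glue f g a ((f a : K) *: eps).
Definition embB (b : B) : G := glue f g ((g b : K) *: e) b.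

Fact embA_linear : linear embA.
Proof.
move=> k a a'; rewrite /embA -glue_linear; congr (glue _ _ _ _).
by rewrite linearP /= scalerDl scalerA.
Qed.
Fact embB_linear : linear embB.
Proof.
move=> k a a'; rewrite /embB -glue_linear; congr (glue _ _ _ _).
by rewrite linearP /= scalerDl scalerA.
Qed.
HB.instance Definition _ := GRing.isLinear.Build K A G *:%R embA embA_linear.
HB.instance Definition _ := GRing.isLinear.Build K B G *:%R embB embB_linear.

Lemma embA_A a : glueA (embA a) = a.
Proof. by apply: (glueK _).1; rewrite linearZ /= geps -[RHS]/(_ * _) mulr1. Qed.
Lemma embA_B a : glueB (embA a) = (f a : K) *: eps.
Proof. by apply: (glueK _).2; rewrite linearZ /= geps -[RHS]/(_ * _) mulr1. Qed.
Lemma embB_B b : glueB (embB b) = b.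
Proof. by apply: (glueK _).2; rewrite linearZ /= fe -[LHS]/(_ * _) mulr1. Qed.
Lemma embB_A b : glueA (embB b) = (g b : K) *: e.
Proof. by apply: (glueK _).1; rewrite linearZ /= fe -[LHS]/(_ * _) mulr1. Qed.

(** The idempotent of the vertex shared by [A] and [B]. *)
Definition vtx : G := glue f g e eps.
Lemma vtxA : glueA vtx = e. Proof. by apply: (glueK _).1; rewrite fe. Qed.
Lemma vtxB : glueB vtx = eps. Proof. by apply: (glueK _).2; rewrite fe. Qed.

Lemma embAM a b : embA (a * b) = embA a * embA b.
Proof.
apply: glue_ext; rewrite rmorphM /= ?embA_A ?embA_B ?rmorphM //.
by rewrite -scalerAl -scalerAr epsE geps scale1r scalerA.
Qed.
Lemma embBM a b : embB (a * b) = embB a * embB b.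
Proof.
apply: glue_ext; rewrite rmorphM /= ?embB_A ?embB_B ?rmorphM //.
by rewrite -scalerAl -scalerAr eE fe scale1r scalerA.
Qed.

(** The left ideal [G (1, eps)] is a copy of [A], and the right ideal [(e, 1) G]
    a copy of [B].  This asymmetry between the sides is why free [B]-modules,
    but in general not free [A]-modules, are projective over [G]. *)
Lemma embA1r x : x * embA 1 = embA (glueA x).
Proof.
apply: glue_ext; rewrite rmorphM /= ?embA_A ?embA_B ?rmorph1 ?mulr1 //.
by rewrite scale1r epsE glue_compat.
Qed.
Lemma embB1l x : embB 1 * x = embB (glueB x).
Proof.
apply: glue_ext; rewrite rmorphM /= ?embB_A ?embB_B ?rmorph1 ?mul1r //.
by rewrite scale1r eE glue_compat.
Qed.

Lemma embBA : embB 1 * embA 1 = vtx.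
Proof.
rewrite embB1l embA_B rmorph1 scale1r.
by apply: glue_ext; rewrite ?vtxA ?vtxB ?embB_B ?embB_A ?geps ?scale1r.
Qed.

Lemma glueA_surj : surj (@glueA _ _ _ f g).
Proof. by move=> a; exists (embA a); apply: embA_A. Qed.
Lemma glueB_surj : surj (@glueB _ _ _ f g).
Proof. by move=> b; exists (embB b); apply: embB_B. Qed.

(** [(1, eps)] acts as the identity exactly when [G] acts through [A]: one way
    by [isA_act], the other by [isA_res]. *)
Definition isA (M : rmod G) := is_descendible embA M.
(** Likewise with [(e, 1)] and [B], by [isB_act] and [isB_res]. *)
Definition isB (M : rmod G) := is_descendible embB M.

Lemma isA_act M : isA M -> forall (v : M) x, ract v (embA (glueA x)) = ract v x.
Proof. by move=> HM v x; rewrite -embA1r ractM HM. Qed.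
Lemma isB_act M : isB M -> forall (v : M) x, ract v (embB (glueB x)) = ract v x.
Proof. by move=> HM v x; rewrite -embB1l ractM HM. Qed.

Lemma isA_res X : isA (resA X).
Proof.
by move=> v; rewrite -[LHS]/(@ract _ _ X v (glueA (embA 1))) embA_A ract1.
Qed.
Lemma isB_res Y : isB (resB Y).
Proof.
by move=> v; rewrite -[LHS]/(@ract _ _ Y v (glueB (embB 1))) embB_B ract1.
Qed.

(** On a module over [B] nothing enters the vertex, and on one over [A] nothing
    leaves it; in both cases only [chi] survives there. *)
Lemma isB_vtx M : isB M -> forall (v : M) x,
  ract (ract v x) vtx = (f (glueA x) : K) *: ract v vtx.
Proof.
move=> HM v x; rewrite -[in LHS](HM v) -!ractM -ractZr; congr ract.
apply: glue_ext; rewrite linearZ /= !rmorphM /= ?vtxA ?vtxB.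
  by rewrite embB_A rmorph1 scale1r eE rmorphM /= fe mulr1.
by rewrite embB_B mul1r epsE glue_compat.
Qed.

Lemma isA_vtx M : isA M -> forall (v : M) x,
  ract (ract v vtx) x = (f (glueA x) : K) *: ract v vtx.
Proof.
move=> HM v x; rewrite -(isA_act HM (ract v vtx)) -ractM -ractZr.
congr ract; apply: glue_ext;
  rewrite linearZ !rmorphM /= ?embA_A ?embA_B ?vtxA ?vtxB ?eE //.
by rewrite -scalerAr epsE geps scale1r.
Qed.

Lemma vtx_idem : vtx * vtx = vtx.
Proof.
by apply: glue_ext; rewrite rmorphM /= ?vtxA ?vtxB ?eE ?epsE ?fe ?geps scale1r.
Qed.

(** Any linear map becomes equivariant once it is cut down to the vertex. *)
Lemma corner_hom M N (t : 'Hom(M, N)) : isB M -> isA N ->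
  exists2 h : 'Hom(M, N),
    mod_hom h & forall x, h x = ract (t (ract x vtx)) vtx.
Proof.
move=> HM HN.
have L : linear ((fun x => ract (t (ract x vtx)) vtx) : M -> N).
  by move=> k x y; rewrite ractDl ractZl linearP ractDl ractZl.
have [h E] := lfun_linear L; exists h => // x a.
by rewrite !E isB_vtx // linearZ ractZl isA_vtx.
Qed.

(** * Decomposition of modules over the gluing *)

Lemma compl_A : glueA (1 - embB 1) = 1 - e.
Proof. by rewrite linearB /= rmorph1 embB_A rmorph1 scale1r. Qed.

Lemma compl_B : glueB (1 - embB 1) = 0.
Proof. by rewrite linearB /= rmorph1 embB_B subrr. Qed.

Lemma embA_embB_absorb x : (1 - embB 1) * x * embA 1 = (1 - embB 1) * x.
Proof.
rewrite embA1r; apply: glue_ext; rewrite ?embA_A // embA_B !rmorphM /=.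
by rewrite compl_A compl_B linearB /= rmorph1 fe subrr !mul0r scale0r.
Qed.

Lemma embB_vtx x : embB 1 * x * vtx = (f (glueA x) : K) *: vtx.
Proof.
apply: glue_ext; rewrite linearZ /= !rmorphM /= ?vtxA ?vtxB.
  by rewrite embB_A rmorph1 scale1r -mulrA eE rmorphM /= fe mulr1.
by rewrite embB_B mul1r epsE glue_compat.
Qed.

Lemma vtx_embA x : vtx * x * embA 1 = (f (glueA x) : K) *: vtx.
Proof.
rewrite -mulrA embA1r; apply: glue_ext;
  rewrite linearZ rmorphM /= ?embA_A ?embA_B ?vtxA ?vtxB ?eE //.
by rewrite -scalerAr epsE geps scale1r.
Qed.

Lemma embB_compl x :
  x * (1 - embB 1) + (1 - embB 1) * x * vtx = (1 - embB 1) * x.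
Proof.
apply: glue_ext; rewrite linearD /= !rmorphM /= ?compl_A ?compl_B ?vtxA.
  rewrite mulrBr mulr1 mulrBl mul1r eE mulrBl -scalerAl eE fe scale1r.
  by rewrite subrKA.
by rewrite mulr0 !mul0r addr0.
Qed.

Lemma vtx_embB : vtx * (1 - embB 1) = 0.
Proof.
apply: glue_ext; rewrite rmorphM linear0 /= ?compl_A ?compl_B ?mulr0 //.
by rewrite vtxA mulrBr mulr1 eE fe scale1r subrr.
Qed.

Section Decomposition.

Variable M : rmod G.

(** Packs the conditions that define [socA] into a single linear map, so that
    [socA] is a kernel. *)
Definition socA_map (m : M) : 'Hom(G, M) :=
  (linfun (ract m) \o (amulr (embA 1) - \1))%VF.

Fact socA_map_linear : linear socA_map.
Proof.
move=> k u v; apply/lfunP=> x.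
by rewrite !(add_lfunE, scale_lfunE, comp_lfunE, lfunE) /= ractDl ractZl.
Qed.
HB.instance Definition _ :=
  GRing.isLinear.Build K M 'Hom(G, M) *:%R socA_map socA_map_linear.

(** The largest submodule on which [G] acts through [A]. *)
Definition socA : {vspace M} := lker (linfun socA_map).

Lemma socAP m :
  reflect (forall x, ract m (x * embA 1) = ract m x) (m \in socA).
Proof.
have E x : socA_map m x = ract m (x * embA 1) - ract m x.
  by rewrite comp_lfunE lfunE !lfun_simpl /= lfunE /= ractBr.
rewrite memv_ker lfunE; apply: (iffP eqP) => [/= /lfunP H x|H].
  by apply/eqP; rewrite -subr_eq0 -E H zero_lfunE.
by apply/lfunP=> x /=; rewrite E H subrr zero_lfunE.
Qed.

Lemma socA_embA m : m \in socA -> ract m (embA 1) = m.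
Proof. by move=> /socAP/(_ 1); rewrite mul1r ract1. Qed.

Lemma socA_submod : is_submod socA.
Proof.
by move=> m a /socAP H; apply/socAP=> x; rewrite -!ractM mulrA H.
Qed.

Lemma socA_compl m : ract m (1 - embB 1) \in socA.
Proof. by apply/socAP=> x; rewrite -!ractM mulrA embA_embB_absorb. Qed.

Lemma socA_vtx m : m \in socA -> ract m vtx = ract m (embB 1).
Proof. by move=> Hm; rewrite -embBA ractM socA_embA //; apply: socA_submod. Qed.

Lemma socA_vtx_act m x : m \in socA ->
  ract (ract m vtx) x = (f (glueA x) : K) *: ract m vtx.
Proof.
move=> Hm; rewrite -(socA_embA (socA_submod x (socA_submod vtx Hm))).
by rewrite -!ractM mulrA vtx_embA ractZr.
Qed.

(** A projection onto [socA] that commutes with [G].  The submodule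
    [socA] contains the corner of [1 - (e, 1)] and meets that of
    [1 - (1, eps)] in zero, so only the part at the vertex has to be
    projected, and there any linear projection will do. *)
Definition socA_proj (m : M) : M :=
  ract m (1 - embB 1) + ract (projv socA (ract m vtx)) vtx.

Fact socA_proj_linear : linear socA_proj.
Proof.
move=> k u v; rewrite /socA_proj !(ractDl, ractZl) linearP ractDl ractZl.
by rewrite scalerDr addrACA.
Qed.

Lemma socA_proj_mem m : socA_proj m \in socA.
Proof.
apply: memvD; first exact: socA_compl.
by apply: socA_submod; apply: memv_proj.
Qed.

Lemma socA_proj_id m : m \in socA -> socA_proj m = m.
Proof.
move=> Hm; rewrite /socA_proj projv_id; last exact: socA_submod.
by rewrite -ractM vtx_idem socA_vtx // ractBr ract1 subrK.
Qed.

Lemma socA_proj_act m x : socA_proj (ract m x) = ract (socA_proj m) x.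
Proof.
rewrite /socA_proj ractDl socA_vtx_act ?memv_proj //.
rewrite -[ract (ract m (1 - embB 1)) x]ractM -embB_compl [in RHS]ractDr.
rewrite (ractM m x) -addrA; congr (_ + _).
have -> : ract (ract m x) vtx =
    (f (glueA x) : K) *: ract m vtx + ract m ((1 - embB 1) * x * vtx).
  rewrite -ractZr -ractDr -ractM -embB_vtx; congr ract.
  by rewrite -mulrDl -mulrDl subrKC mul1r.
have Hs : ract m ((1 - embB 1) * x * vtx) \in socA.
  by rewrite -mulrA ractM; apply: socA_submod; apply: socA_compl.
rewrite linearP /= (projv_id Hs).
by rewrite ractDl ractZl -ractM -[_ * vtx * vtx]mulrA vtx_idem addrC.
Qed.

(** The kernel of [socA_proj] has no component in the corner [1 - (e, 1)], hence
    is a module over [B]. *)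
Lemma decompose : exists X Y, isomorphic M (dsum (resA X) (resB Y)).
Proof.
have [p Ep] := lfun_linear socA_proj_linear.
have Hp : mod_hom p by move=> m x; rewrite !Ep socA_proj_act.
have pp m : p (p m) = p m by rewrite !Ep socA_proj_id ?socA_proj_mem.
have [X [Y [i [P [j [Q [S iP]]]]]]] := split_idempotent Hp pp.
have [Hi HP Hj HQ [Pi Qj Qi Pj E]] := S.
have HX : isA X.
  move=> x; rewrite -[LHS]Pi Hi -[RHS]Pi; congr (P _).
  by rewrite -{1}[x]Pi iP Ep socA_embA ?socA_proj_mem // -Ep -iP Pi.
have HY : isB Y.
  move=> y; rewrite -[LHS]Qj Hj -[RHS]Qj; congr (Q _).
  have := iP (j y); rewrite Pj linear0 Ep => /(congr1 (ractl (1 - embB 1))).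
  rewrite /ractl ract0l ractDl -!ractM vtx_embB ract0r addr0.
  rewrite mulrBr mulr1 mulrBl mul1r embB1l embB_B subrr subr0.
  by rewrite ractBr ract1 => /esym/eqP; rewrite subr_eq0 => /eqP.
exists (desc_mod f embAM X), (desc_mod g embBM Y).
apply: (isomorphic_trans (biproduct_iso S)); apply: dsum_isomorphic.
  by apply: res_desc_iso => //; apply: isA_act.
by apply: res_desc_iso => //; apply: isB_act.
Qed.

End Decomposition.

(** * Extensions over the gluing *)

(** The right ideal [(e, 1) G] is a copy of [B], so free [B]-modules are direct
    summands of free [G]-modules. *)
Lemma free_resB_projective m : projective (resB (free_mod B m)).
Proof.
have Ls : linear ((fun x : {ffun 'I_m -> B} => [ffun i => embB (x i)])
    : resB (free_mod B m) -> free_mod G m).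
  by move=> k x y; apply/ffunP=> i; rewrite !ffunE linearP.
have Lr : linear ((fun x : {ffun 'I_m -> G} => [ffun i => glueB (x i)])
    : free_mod G m -> resB (free_mod B m)).
  by move=> k x y; apply/ffunP=> i; rewrite !ffunE linearP.
have [s Es] := lfun_linear Ls; have [r Er] := lfun_linear Lr.
apply: (@projective_retract _ _ _ (free_mod G m) s r); last exact: free_projective.
- move=> x a; rewrite !Es; apply/ffunP=> i.
  rewrite /= /res_act /= /free_act !ffunE embBM -embB1l mulrA -embBM mulr1 //.
- move=> x a; rewrite !Er; apply/ffunP=> i.
  by rewrite /= /res_act /= /free_act !ffunE rmorphM.
- by move=> x; rewrite Er Es; apply/ffunP=> i; rewrite !ffunE embB_B.
Qed.

Definition chi (x : G) : K := f (glueA x).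

(** The source and the target share only the vertex, so the values of [h] lie
    there, and [G] acts on them by scalars. *)
Lemma mixed_hom_scalar M N (h : 'Hom(M, N)) :
    (isA M /\ isB N) \/ (isB M /\ isA N) -> mod_hom h ->
  forall x a, ract (h x) a = chi a *: h x.
Proof.
move=> HMN Hh.
have E x : ract (h x) vtx = h x.
  rewrite -embBA ractM.
  by case: HMN => -[HM HN]; rewrite ?HN -Hh ?HM ?Hh ?HN // -Hh HM.
move=> x a; case: HMN => -[HM HN].
  by rewrite -Hh -[LHS]E Hh (isB_vtx HN) E.
by rewrite -{1}[h x]E (isA_vtx HN) E.
Qed.

(** A scalar extension is in general not equivariant for the action on [N];
    projecting it onto the image of [phi], where the action is scalar, repairs
    this. *)
Lemma scalar_extend N L Q (k : 'Hom(L, Q)) (phi : 'Hom(L, N))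
    (psi : 'Hom(Q, N)) :
    (forall x a, ract (phi x) a = chi a *: phi x) ->
    (forall x a, psi (ract x a) = chi a *: psi x) ->
    (forall x, psi (k x) = phi x) ->
  exists2 psi' : 'Hom(Q, N), mod_hom psi' & forall x, psi' (k x) = phi x.
Proof.
move=> Hphi Hpsi E; exists (projv (limg phi) \o psi)%VF => [x a|x].
  rewrite !comp_lfunE Hpsi linearZ /=.
  by have /memv_imgP[y _ ->] := memv_proj (limg phi) (psi x).
by rewrite comp_lfunE E projv_id // memv_img ?memvf.
Qed.

(** Maps from [B]-modules to [X] factor through scalar modules, which are
    injective over [B]. *)
Lemma ext_vanish_BA i Y X : ext_vanish i (resB Y) (resA X).
Proof.
apply: (@ext_vanish_res _ _ _ (@glueB _ _ _ f g) i.+1 (resA X)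
  (scal_mod g X)) => //.
- by move=> m j _; apply/ext_vanish_projective/free_resB_projective.
- move=> L Q k H phi Hphi.
  have Ephi := mixed_hom_scalar (or_intror (conj (@isB_res L) (@isA_res X))) Hphi.
  have [|psi Hpsi Epsi] := H phi.
    move=> x b; rewrite -[b in LHS]embB_B [LHS](Hphi x (embB b)) Ephi.
    by rewrite /chi glue_compat embB_B.
  apply: (@scalar_extend (resA X) (resB L) (resB Q) k phi psi Ephi _ Epsi) => x a.
  by rewrite [LHS]Hpsi /chi glue_compat.
- exact/ext_vanish_injective/(scal_injective geps epsE).
Qed.

(** The identity of [A^m] is multiplication by [e] plus multiplication by
    [1 - e].  The former factors through scalars because [e a = f(a) e], the
    latter through [G^m] because [((1 - e) a, 0)] lies in [G]. *)
Lemma free_resA_stable m : stable_retract (resA (free_mod A m))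
  (resB (scal_mod g {ffun 'I_m -> K^o})).
Proof.
pose V : vectType K := {ffun 'I_m -> K^o}.
have Ls : linear ((fun x : {ffun 'I_m -> A} => [ffun i => f (x i)])
    : resA (free_mod A m) -> resB (scal_mod g V)).
  by move=> k x y; apply/ffunP=> i; rewrite !ffunE linearP.
have Lr : linear ((fun c : {ffun 'I_m -> K^o} => [ffun i => (c i : K) *: e])
    : resB (scal_mod g V) -> resA (free_mod A m)).
  by move=> k x y; apply/ffunP=> i; rewrite !ffunE scalerDl scalerA.
have Lj : linear ((fun x : {ffun 'I_m -> A} =>
      [ffun i => (1 - embB 1) * embA (x i)])
    : resA (free_mod A m) -> free_mod G m).
  by move=> k x y; apply/ffunP=> i; rewrite !ffunE linearP mulrDr -scalerAr.
have Lh : linear ((fun x : {ffun 'I_m -> G} => [ffun i => glueA (x i)])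
    : free_mod G m -> resA (free_mod A m)).
  by move=> k x y; apply/ffunP=> i; rewrite !ffunE linearP.
have [s Es] := lfun_linear Ls; have [r Er] := lfun_linear Lr.
have [j Ej] := lfun_linear Lj; have [h Eh] := lfun_linear Lh.
exists (free_mod G m), s, r, j, h; split.
- exact: free_projective.
- move=> x a; rewrite !Es; apply/ffunP=> i.
  rewrite /= /res_act /= /scal_act /free_act !ffunE rmorphM /= mulrC.
  by rewrite -glue_compat.
- move=> c a; rewrite !Er; apply/ffunP=> i.
  rewrite /= /res_act /= /scal_act /free_act !ffunE -scalerAl eE scalerA.
  by rewrite -glue_compat mulrC.
- split=> x a; rewrite ?Ej ?Eh; apply/ffunP=> i.
    rewrite /= /res_act /= /free_act !ffunE embAM -embA1r.
    by rewrite [embA _ * (_ * _)]mulrA [LHS]mulrA embA_embB_absorb mulrA.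
  by rewrite /= /res_act /= /free_act !ffunE rmorphM.
- move=> x; rewrite Er Es Eh Ej; apply/ffunP=> i.
  rewrite !ffunE rmorphM /= compl_A embA_A mulrBl mul1r eE.
  by rewrite addrC subrK.
Qed.

Lemma ext_vanish_AA i X X' :
  ext_vanish i (resA X) (resA X') <-> ext_vanish i X X'.
Proof.
apply: ext_vanish_res_same; first exact: glueA_surj.
by move=> m j; apply/(ext_vanish_stable (free_resA_stable m))/ext_vanish_BA.
Qed.

Lemma ext_vanish_BB i Y Y' :
  ext_vanish i (resB Y) (resB Y') <-> ext_vanish i Y Y'.
Proof.
apply: ext_vanish_res_same; first exact: glueB_surj.
by move=> m j; apply/ext_vanish_projective/free_resB_projective.
Qed.

(** Maps from [A]-modules to [Y] are maps to scalar modules, so Ext(X, Y) is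
    controlled by the extensions of [X] by scalar modules over [A], up to the
    contribution of free [A]-modules, which are stably scalar modules over
    [B]. *)
Lemma ext_vanish_AB n Y :
    (forall (V : vectType K) j, (j < n)%N -> ext_vanish j (scal_mod g V) Y) ->
  forall i X, (i < n)%N -> ext_vanish i X (scal_mod f Y) ->
  ext_vanish i (resA X) (resB Y).
Proof.
move=> HY; apply: ext_vanish_res.
- move=> m j Hj; apply: (ext_vanish_stable (free_resA_stable m)).
  exact/ext_vanish_BB/HY.
- move=> L Q k H phi Hphi.
  have Ephi := mixed_hom_scalar (or_introl (conj (@isA_res L) (@isB_res Y))) Hphi.
  have [|psi Hpsi Epsi] := H phi.
    move=> x a; rewrite -[a in LHS]embA_A [LHS](Hphi x (embA a)) Ephi.
    by rewrite /chi embA_A.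
  apply: (@scalar_extend (resB Y) (resA L) (resA Q) k phi psi Ephi _ Epsi) => x a.
  by rewrite [LHS]Hpsi.
Qed.

(** * Global dimension of the gluing *)

Lemma gldim_glueA d : global_dimension_le G d -> global_dimension_le A d.
Proof.
move=> H X; apply/pd_leP => X'; apply/ext_vanish_AA.
exact/(pd_leP d (resA X)).1/H.
Qed.

Lemma gldim_glueB d : global_dimension_le G d -> global_dimension_le B d.
Proof.
move=> H Y; apply/pd_leP => Y'; apply/ext_vanish_BB.
exact/(pd_leP d (resB Y)).1/H.
Qed.

Section GlobalDimension.

Variables d1 d2 : nat.
Hypothesis gdA : global_dimension_le A d1.
Hypothesis gdB : global_dimension_le B d2.

Lemma ext_vanish_resB j Y N : (d2 <= j)%N -> ext_vanish j (resB Y) N.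
Proof.
move=> Hj; have [X' [Y' I]] := decompose N.
apply: (ext_vanish_iso (isomorphic_refl _) (isomorphic_sym I)).
apply: ext_vanish_dsum_r; first exact: ext_vanish_BA.
apply/ext_vanish_BB; apply: ext_vanishW Hj => Y''.
exact/(pd_leP d2 Y).1/gdB.
Qed.

Lemma ext_vanish_free_resA j m N :
  (d2 <= j)%N -> ext_vanish j (resA (free_mod A m)) N.
Proof.
move=> Hj; apply: ext_vanish_stable (free_resA_stable m) _.
exact: ext_vanish_resB.
Qed.

(** Each step of an [A]-resolution costs one degree, and its free terms cost
    [d2]. *)
Lemma ext_vanish_resA m X N :
  (forall X', ext_vanish m X X') -> ext_vanish (m + d2) (resA X) N.
Proof.
elim: m X => [|m IH] X H; have [n [p [Hp Sp]]] := free_cover X.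
  have HX := ext_vanish_projectiveP H.
  have [s Hs ps] := projective_lift HX Hp (@hom_id _ _ X) Sp.
  apply: (@ext_vanish_retract _ _ _ (resA X) (resA (free_mod A n)) N s p);
    try exact: hom_res.
    by move=> x; rewrite ps id_lfunE.
  exact: ext_vanish_free_resA.
have [L [k Sk]] := ker_ses Hp Sp.
apply: (ext_vanish_quotient (ses_res _ Sk)).
  by apply: IH => X'; apply: H Sk; apply: free_projective.
by apply: ext_vanish_free_resA; rewrite leqW // leq_addl.
Qed.

Lemma gldim_glue : global_dimension_le G (d1 + d2).
Proof.
move=> M; apply/pd_leP => N; have [X [Y I]] := decompose M.
apply: (ext_vanish_iso (isomorphic_sym I) (isomorphic_refl N)).
apply: ext_vanish_dsum_l.
  by apply: ext_vanish_resA => X'; apply/(pd_leP d1 X).1/gdA.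
by apply: ext_vanish_resB; apply: leq_addl.
Qed.

(** * Cluster tilting over the gluing *)

Lemma glue_cluster_tilting n (CA : rmod A -> Prop) (CB : rmod B -> Prop) :
    n_cluster_tilting n CA -> n_cluster_tilting n CB ->
  n_cluster_tilting n (fun M => exists X Y,
    [/\ CA X, CB Y & isomorphic M (dsum (resA X) (resB Y))]).
Proof.
move=> /(cluster_tiltingP n CA gdA)[CA1 CA2] /(cluster_tiltingP n CB gdB)[CB1 CB2].
apply/(cluster_tiltingP n _ gldim_glue).
have scalA V : CA (scal_mod f V).
  by apply/CA2 => i X _ _; apply/ext_vanish_projective/(scal_projective fe eE).
have scalB V : CB (scal_mod g V).
  by apply/CB1 => i Y _ _; apply/ext_vanish_injective/(scal_injective geps epsE).
have CAB X Y : CA X -> CB Y -> forall i, (i.+1 < n)%N ->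
    ext_vanish i (resA X) (resB Y).
  move=> HX HY i Hi; apply: (@ext_vanish_AB n.-1).
  - by move=> V j Hj; apply: (CB1 Y).1 HY _ _ _ (scalB V); rewrite -ltn_predRL.
  - by rewrite ltn_predRL.
  - by apply: (CA1 _).1 (scalA Y) _ _ Hi HX.
have CC X Y X' Y' : CA X -> CB Y -> CA X' -> CB Y' -> forall i, (i.+1 < n)%N ->
    ext_vanish i (dsum (resA X) (resB Y)) (dsum (resA X') (resB Y')).
  move=> HX HY HX' HY' i Hi; apply: ext_vanish_dsum_l; apply: ext_vanish_dsum_r.
  - by apply/ext_vanish_AA; apply: (CA1 X').1 HX' _ _ Hi HX.
  - exact: CAB.
  - exact: ext_vanish_BA.
  - by apply/ext_vanish_BB; apply: (CB1 Y').1 HY' _ _ Hi HY.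
(* To test against [X] alone, test against its sum with some object on the
   other side. *)
have A_in X : CA X ->
    exists2 Y, CB Y & exists X' Y', [/\ CA X', CB Y'
      & isomorphic (dsum (resA X) (resB Y)) (dsum (resA X') (resB Y'))].
  move=> HX; exists (scal_mod g K^o) => //; exists X, (scal_mod g K^o).
  by split=> //; apply: isomorphic_refl.
have B_in Y : CB Y ->
    exists2 X, CA X & exists X' Y', [/\ CA X', CB Y'
      & isomorphic (dsum (resA X) (resB Y)) (dsum (resA X') (resB Y'))].
  move=> HY; exists (scal_mod f K^o) => //; exists (scal_mod f K^o), Y.
  by split=> //; apply: isomorphic_refl.
have inl_retr X Y := dsum_biproduct (resA X) (resB Y).
split=> M; split.
- move=> [X [Y [HX HY I]]] i N Hi [X' [Y' [HX' HY' I']]].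
  apply: (ext_vanish_iso (isomorphic_sym I') (isomorphic_sym I)).
  exact: CC.
- move=> H; have [X [Y I]] := decompose M; exists X, Y.
  have [iX [p [j [q [Hi Hp Hj Hq [pi qj _ _ _]]]]]] := iso_biproduct I.
  split=> //.
    apply/CA1 => i X' Hin HX'; have [Y' HY' CXY] := A_in X' HX'.
    have [i1 [p1 [_ [_ [Hi1 Hp1 _ _ [p1i1 _ _ _ _]]]]]] := inl_retr X' Y'.
    apply/ext_vanish_AA; apply: (ext_vanish_retract_r Hi Hp pi).
    exact: (ext_vanish_retract Hi1 Hp1 p1i1) (H i _ Hin CXY).
  apply/CB1 => i Y' Hin HY'; have [X' HX' CXY] := B_in Y' HY'.
  have [_ [_ [j1 [q1 [_ _ Hj1 Hq1 [_ q1j1 _ _ _]]]]]] := inl_retr X' Y'.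
  apply/ext_vanish_BB; apply: (ext_vanish_retract_r Hj Hq qj).
  exact: (ext_vanish_retract Hj1 Hq1 q1j1) (H i _ Hin CXY).
- move=> [X [Y [HX HY I]]] i N Hi [X' [Y' [HX' HY' I']]].
  apply: (ext_vanish_iso (isomorphic_sym I) (isomorphic_sym I')).
  exact: CC.
- move=> H; have [X [Y I]] := decompose M; exists X, Y.
  have [iX [p [j [q [Hi Hp Hj Hq [pi qj _ _ _]]]]]] := iso_biproduct I.
  split=> //.
    apply/CA2 => i X' Hin HX'; have [Y' HY' CXY] := A_in X' HX'.
    have [i1 [p1 [_ [_ [Hi1 Hp1 _ _ [p1i1 _ _ _ _]]]]]] := inl_retr X' Y'.
    apply/ext_vanish_AA; apply: (ext_vanish_retract_r Hi1 Hp1 p1i1).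
    exact: (ext_vanish_retract Hi Hp pi) (H i _ Hin CXY).
  apply/CB2 => i Y' Hin HY'; have [X' HX' CXY] := B_in Y' HY'.
  have [_ [_ [j1 [q1 [_ _ Hj1 Hq1 [_ q1j1 _ _ _]]]]]] := inl_retr X' Y'.
  apply/ext_vanish_BB; apply: (ext_vanish_retract_r Hj1 Hq1 q1j1).
  exact: (ext_vanish_retract Hj Hq qj) (H i _ Hin CXY).
Qed.

End GlobalDimension.

(** * Cycles of modules over the gluing *)

Lemma indecomposable_AB M : indecomposable M -> isA M \/ isB M.
Proof.
move=> [_ H]; have [X [Y I]] := decompose M.
have [i [p [j [q [Hi Hp Hj Hq [pi qj qi pj E]]]]]] := iso_biproduct I.
have [/zero_modP Z|/zero_modP Z] := H _ _ I.
  right=> v; rewrite -[v]E (Z (p v)) linear0 add0r -Hj.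
  by congr (j _); apply: isB_res.
left=> v; rewrite -[v]E (Z (q v)) linear0 addr0 -Hi.
by congr (i _); apply: isA_res.
Qed.

(** A linear quasi-inverse of [h], cut down to the vertex, is an equivariant map
    [t] with [h t h = h].  So [t h] and [h t] are idempotents of indecomposable
    modules, and nonzero since [h] is. *)
Lemma isA_isB_iso M N (h : 'Hom(M, N)) :
    indecomposable M -> indecomposable N -> isA M -> isB N ->
    mod_hom h -> h != 0 ->
  mod_iso h.
Proof.
move=> IM IN HM HN Hh h0.
have hE x : ract (h x) vtx = h x.
  by rewrite -embBA ractM HN -Hh HM.
have [t Ht Et] := corner_hom h^-1%VF HN HM.
have hth x : h (t (h x)) = h x.
  rewrite Et hE Hh limg_lfunVK ?hE //.
  by apply: memv_img; apply: memvf.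
have nz : ~ forall x, h x = 0.
  by move=> Z; move/eqP: h0; apply; apply/lfunP=> x; rewrite Z zero_lfunE.
have [x|Z|th] := indecomposable_idempotent IM (hom_comp Ht Hh).
- by rewrite !comp_lfunE hth.
- by case: nz => x; rewrite -hth -[t (h x)]comp_lfunE Z linear0.
have [x|Z|ht] := indecomposable_idempotent IN (hom_comp Hh Ht).
- by rewrite !comp_lfunE hth.
- by case: nz => x; rewrite -hth -[h (t _)]comp_lfunE Z.
split=> //; exists t => x; by rewrite -comp_lfunE.
Qed.

Lemma isA_iso M N : isomorphic M N -> isA M -> isA N.
Proof.
case/isomorphicP=> h [k [Hh Hk kh hk]] HM v.
by rewrite -[v]hk -Hh HM.
Qed.

(** Once a chain of nonzero nonisomorphisms enters the [A]-modules it never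
    leaves them, so a cycle lies on one side. *)
Lemma glue_directed : representation_directed A -> representation_directed B ->
  representation_directed G.
Proof.
move=> dirA dirB t M h t0 indM Hh I.
have stepA i : (i < t)%N -> isA (M i) -> isA (M i.+1).
  move=> Hi HA; have [hom_h h0 h_iso] := Hh i Hi.
  have [//|HB] := indecomposable_AB (indM i.+1 Hi).
  by case: h_iso; apply: isA_isB_iso => //; apply: indM; rewrite // ltnW.
have fromA i : (i <= t)%N -> isA (M i) -> forall j, (i <= j <= t)%N -> isA (M j).
  move=> Hi HA; elim=> [|j IH] /andP[Hij Hjt].
    by move: Hij; rewrite leqn0 => /eqP E; rewrite -E.
  move: Hij; rewrite leq_eqVlt => /orP[/eqP <- //|Hij].
  by apply: stepA => //; apply: IH; rewrite -ltnS Hij ltnW.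
have [HA|HA] := classic (isA (M 0%N)).
  apply: (directed_descent f embAM isA_act glueA_surj dirA t0 indM Hh _ I) => i Hi.
  by apply: (fromA 0%N).
apply: (directed_descent g embBM isB_act glueB_surj dirB t0 indM Hh _ I) => i Hi.
have [HAi|//] := indecomposable_AB (indM i Hi).
case: HA; apply: (isA_iso (isomorphic_sym I)).
by apply: (fromA i) => //; rewrite Hi leqnn.
Qed.

End Gluing.

(** * Simple modules generated by an idempotent *)

Section SimpleIdempotent.

Variables (K : fieldType) (A : falgType K) (chi : {lrmorphism A -> K^o}).
Implicit Types M N : rmod A.

Lemma simple_iso M N : isomorphic M N -> simple_mod M -> simple_mod N.
Proof.
move=> I [NZ H]; have [f [g [Hf Hg gf fg]]] := (isomorphicP _ _).1 I.
split=> [Z|U HU]; first by apply: NZ; apply/(zero_mod_iso _ Z)/isomorphic_sym.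
have HV : is_submod (g @: U)%VS.
  move=> _ a /memv_imgP[u Uu ->]; rewrite -Hg; apply: memv_img; exact: HU.
have [E|E] := H _ HV.
  left; apply/eqP; rewrite -subv0; apply/subvP=> u Uu.
  have /eqP E0 : g u == 0 by rewrite -memv0 -E memv_img.
  by rewrite -[u]fg E0 linear0 mem0v.
right; apply/eqP; rewrite eqEsubv subvf; apply/subvP=> u _.
have : g u \in (g @: U)%VS by rewrite E memvf.
by case/memv_imgP=> v Uv /(congr1 f); rewrite !fg => ->.
Qed.

Variable e : A.
Hypothesis chie : chi e = 1.

(** The kernel of [chi] on [e A] is a proper submodule, hence zero. *)
Lemma simple_eA : Defs.idempotent e -> simple_mod (eA_mod e) ->
  forall a, e * a = (chi a : K) *: e.
Proof.
move=> ee [_ H] a.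
have Ll : linear ((fun v : eA_mod e => chi (vsval v)) : eA_mod e -> K^o).
  by move=> k u v; rewrite !linearP.
have [l El] := lfun_linear Ll.
have HU : is_submod (lker l).
  move=> v b; rewrite !memv_ker !El vsval_eA_act rmorphM /= mulf_eq0.
  by move=> ->.
have mem b : e * b \in eA e by apply/eA_memP; exists b.
have ve b : vsval (vsproj (eA e) (e * b)) = e * b by rewrite vsprojK.
have [E|E] := H _ HU; last first.
  have : vsproj (eA e) (e * 1) \in lker l by rewrite E memvf.
  by rewrite memv_ker El ve mulr1 chie oner_eq0.
have : vsproj (eA e) (e * (a - (chi a : K) *: 1)) \in lker l.
  rewrite memv_ker El ve rmorphM /= chie mul1r linearB /= linearZ /= rmorph1.
  by rewrite -[_ *: 1]/(_ * _) mulr1 subrr.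
rewrite E memv0 => /eqP/(congr1 (@vsval _ _ _)); rewrite ve linear0.
by rewrite mulrBr -scalerAr mulr1 => /eqP; rewrite subr_eq0 => /eqP.
Qed.

Lemma functional_separates (V : vectType K) (x : V) :
  (forall phi : 'Hom(V, K^o), phi x = 0) -> x = 0.
Proof.
move=> H; rewrite (coord_vbasis (memvf x)); apply: big1 => i _.
have L : linear (coord (vbasis {:V}) i : V -> K^o).
  by move=> k u v; rewrite linearP.
have [phi E] := lfun_linear L.
by rewrite -E H scale0r.
Qed.

(** The functional [chi] spans a submodule of [D(A e)], hence all of it, so an
    element of [A e] killed by [chi] is killed by every functional. *)
Lemma simple_DAe : Defs.idempotent e -> simple_mod (DAe_mod e) ->
  forall a, a * e = (chi a : K) *: e.
Proof.
move=> ee [_ H] a.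
have Lc : linear ((fun v : subvs_of (Ae e) => chi (vsval v))
    : subvs_of (Ae e) -> K^o).
  by move=> k u v; rewrite !linearP.
have [c Ec] := lfun_linear Lc.
have mem b : b * e \in Ae e by apply/Ae_memP; exists b.
have ve b : vsval (vsproj (Ae e) (b * e)) = b * e by rewrite vsprojK.
have HU : @is_submod _ _ (DAe_mod e) <[c]>%VS.
  move=> _ b /vlineP[k ->]; apply/vlineP; exists (k * chi b).
  apply/lfunP=> v; rewrite DAe_actE !scale_lfunE !Ec vsval_Ae_lact rmorphM /=.
  by rewrite -!/(_ * _) -[RHS]mulrA.
have [E|E] := H _ HU.
  have : c \in (0 : {vspace DAe_mod e})%VS by rewrite -E memv_line.
  rewrite memv0 => /eqP/lfunP/(_ (vsproj (Ae e) (1 * e))).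
  by rewrite Ec ve mul1r chie zero_lfunE => /eqP; rewrite oner_eq0.
have : vsproj (Ae e) ((a - (chi a : K) *: 1) * e) = 0.
  apply: functional_separates => phi.
  have : phi \in (fullv : {vspace DAe_mod e})%VS by rewrite memvf.
  rewrite -E => /vlineP[k ->]; rewrite scale_lfunE Ec ve rmorphM /= chie mulr1.
  rewrite linearB /= linearZ /= rmorph1 -[_ *: 1]/(_ * _) mulr1 subrr.
  by rewrite scaler0.
move/(congr1 (@vsval _ _ _)); rewrite ve linear0.
by rewrite mulrBl -scalerAl mul1r => /eqP; rewrite subr_eq0 => /eqP.
Qed.

End SimpleIdempotent.

(** * Basic algebras *)

Section Basic.

Variables (K : fieldType) (A : falgType K).
Implicit Types e : A.

(** The isomorphism of [e1 A] with [e2 A] in terms of elements, a form that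
    algebra morphisms transport. *)
Definition matched e1 e2 : Prop :=
  exists x y : A, [/\ e2 * x = x, e1 * y = y, x * y = e2 & y * x = e1].

Lemma isomorphic_matched e1 e2 : Defs.idempotent e1 -> Defs.idempotent e2 ->
  isomorphic (eA_mod e1) (eA_mod e2) <-> matched e1 e2.
Proof.
move=> i1 i2.
have mem e b : e * b \in eA e by apply/eA_memP; exists b.
have vK e (v : eA_mod e) : Defs.idempotent e -> e * vsval v = vsval v.
  by move=> ie; have /eA_memP[b ->] := subvsP v; rewrite mulrA ie.
have hom_act e e' (h : 'Hom(eA_mod e, eA_mod e')) v b : mod_hom h ->
    vsval (h (vsproj (eA e) (vsval v * b))) = vsval (h v) * b.
  by move=> Hh; rewrite -vsval_eA_act; congr vsval; apply: Hh.
split=> [/isomorphicP[h [k [Hh Hk kh hk]]]|[x [y [e2x e1y xy yx]]]].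
  pose g e := vsproj (eA e) (e * 1).
  have gE e : vsval (g e) = e by rewrite vsprojK // mulr1.
  have gP e (v : eA_mod e) : Defs.idempotent e ->
      v = vsproj (eA e) (vsval (g e) * vsval v).
    by move=> ie; apply: val_inj; rewrite /= gE vK // vsvalK.
  exists (vsval (h (g e1))), (vsval (k (g e2))); split.
  - exact: vK.
  - exact: vK.
  - by rewrite -hom_act // -gP // hk gE.
  - by rewrite -hom_act // -gP // kh gE.
have memM e (v : eA_mod e) a : vsval v * a \in eA e.
  by rewrite -(vsval_eA_act v a) subvsP.
have memx v : x * v \in eA e2 by rewrite -e2x -mulrA.
have memy v : y * v \in eA e1 by rewrite -e1y -mulrA.
have Lh : linear ((fun v => vsproj (eA e2) (x * vsval v))
    : eA_mod e1 -> eA_mod e2).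
  by move=> c u v; rewrite linearP mulrDr -scalerAr linearP.
have Lk : linear ((fun v => vsproj (eA e1) (y * vsval v))
    : eA_mod e2 -> eA_mod e1).
  by move=> c u v; rewrite linearP mulrDr -scalerAr linearP.
have [h Eh] := lfun_linear Lh; have [k Ek] := lfun_linear Lk.
apply/isomorphicP; exists h, k; split.
- move=> v a; apply: val_inj; rewrite [RHS]vsval_eA_act !Eh !vsprojK ?mulrA //.
  by rewrite /= -mulrA vsprojK.
- move=> v a; apply: val_inj; rewrite [RHS]vsval_eA_act !Ek !vsprojK ?mulrA //.
  by rewrite /= -mulrA vsprojK.
- by move=> v; apply: val_inj; rewrite Ek Eh /= !vsprojK // mulrA yx vK.
- by move=> v; apply: val_inj; rewrite Ek Eh /= !vsprojK // mulrA xy vK.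
Qed.

Lemma basic_of_finType (T : finType) (E : T -> A) :
    (forall i, primitive_idempotent (E i)) ->
    (forall i j, i != j -> E i * E j = 0) ->
    \sum_i E i = 1 ->
    (forall i j, i != j -> ~ matched (E i) (E j)) ->
  basic_algebra A.
Proof.
move=> prim orth sum1 noniso.
have neq (i j : 'I_#|T|) : i != j -> enum_val i != enum_val j.
  by rewrite (inj_eq enum_val_inj).
exists #|T|, (fun i => E (enum_val i)); split=> [i|i j /neq|| i j /neq ij].
- exact: prim.
- exact: orth.
- by rewrite -sum1 (reindex _ (onW_bij _ (enum_val_bij T))).
- move/isomorphic_matched=> H; apply: (noniso _ _ ij); apply: H.
    by case: (prim (enum_val i)).
  by case: (prim (enum_val j)).
Qed.

Variables (m : nat) (E : 'I_m -> A) (chi : {lrmorphism A -> K^o}).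
Hypotheses (primE : forall i, primitive_idempotent (E i))
  (orthE : forall i j, i != j -> E i * E j = 0) (sumE : \sum_i E i = 1).

(** The values [chi (E i)] are orthogonal idempotents of a field with sum [1]. *)
Lemma character_vertex :
  exists i, chi (E i) = 1 /\ forall j, j != i -> chi (E j) = 0.
Proof.
have [i Hi] : exists i, chi (E i) != 0.
  apply/existsP; apply: contraT; rewrite negb_exists => /forallP H.
  have := rmorph1 chi; rewrite -sumE rmorph_sum /= big1 => [/eqP|i _].
    by rewrite eq_sym oner_eq0.
  by apply/eqP; rewrite -[_ == _]negbK.
exists i; split=> [|j ji].
  have [ii _ _] := primE i; apply: (mulfI Hi).
  by rewrite mulr1 -[LHS](rmorphM chi) ii.
apply: (mulIf Hi); rewrite mul0r -[LHS](rmorphM chi) orthE ?rmorph0 //.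
Qed.

(** The given [e] need not be one of the [E i], but [E i] satisfies the same
    identity: [E i * e] is a nonzero idempotent of the corner of [E i], hence
    is [E i] by primitivity. *)
Lemma left_vertex e i :
    chi e = 1 -> (forall a, e * a = (chi a : K) *: e) -> chi (E i) = 1 ->
  forall a, E i * a = (chi a : K) *: E i.
Proof.
move=> chie eA_ chiE.
have ei : e * E i = e by rewrite eA_ chiE scale1r.
have ee : e * e = e by rewrite eA_ chie scale1r.
have [ii _ prim] := primE i.
suff E0 : E i * e = E i by move=> a; rewrite -{1}E0 -mulrA eA_ -scalerAr E0.
have [|||||Z|] := prim (E i * e) (E i - E i * e).
- by rewrite /Defs.idempotent mulrA -[E i * e * E i]mulrA ei -mulrA ee.
- rewrite /Defs.idempotent mulrBr !mulrBl ii mulrA ii -[E i * e * E i]mulrA ei.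
  by rewrite mulrA -[E i * e * E i]mulrA ei -mulrA ee subrr subr0.
- by rewrite mulrBr mulrA -[E i * e * E i]mulrA ei -mulrA ee subrr.
- by rewrite mulrBl mulrA ii mulrA -[E i * e * E i]mulrA ei -mulrA ee subrr.
- by rewrite addrC subrK.
- by have := congr1 chi Z; rewrite rmorphM /= chie chiE mulr1 rmorph0 => /eqP;
    rewrite oner_eq0.
- by move/eqP; rewrite subr_eq0 => /eqP <-.
Qed.

Lemma right_vertex e i :
    chi e = 1 -> (forall a, a * e = (chi a : K) *: e) -> chi (E i) = 1 ->
  forall a, a * E i = (chi a : K) *: E i.
Proof.
move=> chie Ae_ chiE.
have ei : E i * e = e by rewrite Ae_ chiE scale1r.
have ee : e * e = e by rewrite Ae_ chie scale1r.
have [ii _ prim] := primE i.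
suff E0 : e * E i = E i by move=> a; rewrite -{1}E0 mulrA Ae_ -scalerAl E0.
have [|||||Z|] := prim (e * E i) (E i - e * E i).
- by rewrite /Defs.idempotent mulrA -[e * E i * e]mulrA ei ee.
- rewrite /Defs.idempotent mulrBr !mulrBl ii mulrA ei -[e * E i * E i]mulrA ii.
  by rewrite mulrA -[e * E i * e]mulrA ei ee subrr subr0.
- by rewrite mulrBr -mulrA ii mulrA -[e * E i * e]mulrA ei ee subrr.
- by rewrite mulrBl mulrA ei mulrA -[e * E i * e]mulrA ei ee subrr.
- by rewrite addrC subrK.
- by have := congr1 chi Z; rewrite rmorphM /= chie chiE mulr1 rmorph0 => /eqP;
    rewrite oner_eq0.
- by move/eqP; rewrite subr_eq0 => /eqP <-.
Qed.

End Basic.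

(** * The gluing is basic *)

Section GlueBasic.

Variables (K : fieldType) (A B : falgType K).
Variables (f : {lrmorphism A -> K^o}) (g : {lrmorphism B -> K^o}).
Variables (m1 m2 : nat) (EA : 'I_m1 -> A) (EB : 'I_m2 -> B).
Variables (i0 : 'I_m1) (j0 : 'I_m2).

Hypotheses (primA : forall i, primitive_idempotent (EA i))
  (orthA : forall i j, i != j -> EA i * EA j = 0) (sumA : \sum_i EA i = 1)
  (isoA : forall i j, i != j -> ~ isomorphic (eA_mod (EA i)) (eA_mod (EA j))).
Hypotheses (primB : forall i, primitive_idempotent (EB i))
  (orthB : forall i j, i != j -> EB i * EB j = 0) (sumB : \sum_i EB i = 1)
  (isoB : forall i j, i != j -> ~ isomorphic (eA_mod (EB i)) (eA_mod (EB j))).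
Hypotheses (f_i0 : f (EA i0) = 1) (f_other : forall i, i != i0 -> f (EA i) = 0)
  (i0E : forall a, EA i0 * a = (f a : K) *: EA i0).
Hypotheses (g_j0 : g (EB j0) = 1)
  (j0E : forall b, b * EB j0 = (g b : K) *: EB j0).

Local Notation G := (gluing f g).
Local Notation embA := (embA f g (EB j0)).
Local Notation embB := (embB f g (EA i0)).

Lemma orthogonal_sum0 (S : falgType K) (x y : S) :
  Defs.idempotent x -> x * y = 0 -> x + y = 0 -> x = 0.
Proof. by move=> xx xy s0; rewrite -xx -[LHS]addr0 -xy -mulrDr s0 mulr0. Qed.

Lemma embA_primitive a : f a = 0 -> primitive_idempotent a ->
  primitive_idempotent (embA a).
Proof.
move=> fa [aa a0 prim]; split.
- by rewrite /Defs.idempotent -embAM // aa.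
- by apply: contra_neq a0 => E; rewrite -(embA_A f g_j0 a) E linear0.
move=> x y xx yy xy yx E.
have gB (u v : G) : u * v = 0 -> glueB u * glueB v = 0.
  by move=> uv; rewrite -rmorphM uv /= linear0.
have gA (u v : G) : u * v = 0 -> glueA u * glueA v = 0.
  by move=> uv; rewrite -rmorphM uv /= linear0.
have iA (u : G) : Defs.idempotent u -> Defs.idempotent (glueA u).
  by move=> uu; rewrite /Defs.idempotent -rmorphM uu.
have iB (u : G) : Defs.idempotent u -> Defs.idempotent (glueB u).
  by move=> uu; rewrite /Defs.idempotent -rmorphM uu.
have sB : glueB x + glueB y = 0.
  by rewrite -linearD /= -E embA_B // fa scale0r.
have xB : glueB x = 0 := orthogonal_sum0 (iB _ xx) (gB _ _ xy) sB.
have yB : glueB y = 0.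
  by apply: (orthogonal_sum0 (iB _ yy) (gB _ _ yx)); rewrite addrC.
have sA : a = glueA x + glueA y by rewrite -linearD /= -E embA_A.
have [Z|Z] := prim _ _ (iA _ xx) (iA _ yy) (gA _ _ xy) (gA _ _ yx) sA.
  by left; apply: glue_ext; rewrite linear0.
by right; apply: glue_ext; rewrite linear0.
Qed.

(** At the common vertex the two coordinates of a summand are tied by [f] and
    [g], so a summand that vanishes in [B] vanishes. *)
Lemma embB_summand0 b (x y : G) :
  Defs.idempotent x -> y * x = 0 -> embB b = x + y -> glueB x = 0 -> x = 0.
Proof.
move=> xx yx E xB; apply: glue_ext; rewrite linear0 //=.
have -> : x = embB b * x by rewrite E mulrDl xx yx addr0.
rewrite rmorphM /= embB_A // -scalerAl i0E glue_compat xB rmorph0.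
by rewrite scale0r scaler0.
Qed.

Lemma embB_primitive b : primitive_idempotent b ->
  primitive_idempotent (embB b).
Proof.
move=> [bb b0 prim]; split.
- by rewrite /Defs.idempotent -embBM // bb.
- by apply: contra_neq b0 => E; rewrite -(embB_B g f_i0 b) E linear0.
move=> x y xx yy xy yx E.
have gB (u v : G) : u * v = 0 -> glueB u * glueB v = 0.
  by move=> uv; rewrite -rmorphM uv /= linear0.
have iB (u : G) : Defs.idempotent u -> Defs.idempotent (glueB u).
  by move=> uu; rewrite /Defs.idempotent -rmorphM uu.
have sB : b = glueB x + glueB y by rewrite -linearD /= -E embB_B.
have [Z|Z] := prim _ _ (iB _ xx) (iB _ yy) (gB _ _ xy) (gB _ _ yx) sB.
  by left; apply: embB_summand0 E Z.
by right; apply: (@embB_summand0 b y x) => //; rewrite E addrC.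
Qed.

Lemma matched_rmorphism (S T : falgType K) (h : {lrmorphism S -> T}) e1 e2 :
  matched e1 e2 -> matched (h e1) (h e2).
Proof.
move=> [x [y [e2x e1y xy yx]]]; exists (h x), (h y).
by rewrite -!rmorphM e2x e1y xy yx.
Qed.

(** Take the [(E i, 0)] for the vertices [i] of [A] other than [i0], and the
    [embB (E j)] for all vertices [j] of [B]; for [j = j0] the latter is the
    common vertex. *)
Lemma glue_basic : basic_algebra G.
Proof.
have zeroB i : i != i0 -> glueB (embA (EA i)) = 0.
  by move=> Hi; rewrite embA_B // f_other // scale0r.
have noA i j : i != j -> ~ matched (EA i) (EA j).
  move=> ij H; apply: (isoA ij); apply/isomorphic_matched => //.
    by case: (primA i).
  by case: (primA j).
have noB i j : i != j -> ~ matched (EB i) (EB j).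
  move=> ij H; apply: (isoB ij); apply/isomorphic_matched => //.
    by case: (primB i).
  by case: (primB j).
have orthAB i j : i != i0 -> embA (EA i) * embB (EB j) = 0.
  move=> Hi; apply: glue_ext; rewrite linear0 rmorphM /=.
    by rewrite embA_A // embB_A // -scalerAr orthA // scaler0.
  by rewrite zeroB // mul0r.
have orthBA i j : i != i0 -> embB (EB j) * embA (EA i) = 0.
  move=> Hi; apply: glue_ext; rewrite linear0 rmorphM /=.
    by rewrite embA_A // embB_A // -scalerAl i0E f_other // scale0r scaler0.
  by rewrite zeroB // mulr0.
pose E (t : {i : 'I_m1 | i != i0} + 'I_m2) : G :=
  match t with inl i => embA (EA (val i)) | inr j => embB (EB j) end.
apply: (@basic_of_finType _ _ _ E).
- case=> [[i Hi]|j] /=; last exact: embB_primitive.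
  by apply: embA_primitive => //; apply: f_other.
- move=> [[i Hi]|j] [[i' Hi']|j'] neq /=.
  + by rewrite -embAM // orthA ?linear0.
  + exact: orthAB.
  + exact: orthBA.
  + by rewrite -embBM // orthB ?linear0.
- rewrite big_sumType /= -!linear_sum /= sumB.
  have -> : \sum_(i : {i : 'I_m1 | i != i0}) EA (val i) = 1 - EA i0.
    rewrite -sumA (bigD1 i0) //= [X in X - _]addrC addrK.
    rewrite (reindex_omap (val : {i : 'I_m1 | i != i0} -> _) insub); last first.
      by move=> i Hi; rewrite insubT.
    by apply: eq_bigl => -[i Hi] /=; rewrite Hi insubT /= eqxx.
  apply: glue_ext; rewrite linearD /= rmorph1.
    by rewrite embA_A // embB_A // rmorph1 scale1r subrK.
  by rewrite embA_B // embB_B // linearB /= rmorph1 f_i0 subrr scale0r add0r.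
- move=> [[i Hi]|j] [[i' Hi']|j'] neq /= H.
  + apply: (noA i i' neq).
    by have := matched_rmorphism (@glueA _ _ _ f g) H; rewrite /= !embA_A.
  + have := matched_rmorphism (@glueB _ _ _ f g) H; rewrite /= zeroB // embB_B //.
    case=> x [y [_ y0 E1 _]]; have [_ /negP] := primB j'; case.
    by rewrite -E1 -y0 mul0r mulr0.
  + have := matched_rmorphism (@glueB _ _ _ f g) H; rewrite /= zeroB // embB_B //.
    case=> x [y [x0 _ _ E1]]; have [_ /negP] := primB j; case.
    by rewrite -E1 -x0 mul0r mulr0.
  + apply: (noB j j' neq).
    by have := matched_rmorphism (@glueB _ _ _ f g) H; rewrite /= !embB_B.
Qed.

End GlueBasic.

(** * Strong representation-directedness of the gluing *)

Lemma least_nat (P : nat -> Prop) n : P n ->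
  exists2 m, P m & forall k, P k -> (m <= k)%N.
Proof.
elim: n {-2}n (leqnn n) => [|n IH] m Hm Pm.
  by exists m => // k _; move: Hm; rewrite leqn0 => /eqP ->.
have [[k [Pk km]]|H] := classic (exists k, P k /\ (k < m)%N).
  by apply: IH Pk; rewrite -ltnS (leq_trans km).
exists m => // k Pk; rewrite leqNgt; apply/negP => km.
by apply: H; exists k.
Qed.

Theorem corollary3p17 (K : closedFieldType) (n d1 d2 : nat)
    (A B : falgType K)
    (hn : (1 <= n)%N)
    (hA : strongly_representation_directed n d1 A)
    (hB : strongly_representation_directed n d2 B)
    (P : rmod A) (hPs : simple_mod P) (hPp : projective P)
    (I : rmod B) (hIs : simple_mod I) (hIi : injective_mod I)
    (e : A) (he : primitive_idempotent e) (hPe : isomorphic P (eA_mod e))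
    (eps : B) (heps : primitive_idempotent eps)
    (hIeps : isomorphic I (DAe_mod eps))
    (f : {lrmorphism A -> K^o}) (hfe : f e = 1) (hf1e : f (1 - e) = 0)
    (g : {lrmorphism B -> K^o}) (hge : g eps = 1) (hg1e : g (1 - eps) = 0) :
  exists d : nat,
    [/\ (maxn d1 d2 <= d)%N, (d <= d1 + d2)%N
      & strongly_representation_directed n d (gluing f g)].
Proof.
have [[m1 [EA [primA orthA sumA isoA]]] dirA [gdA minA] [CA ctA]] := hA.
have [[m2 [EB [primB orthB sumB isoB]]] dirB [gdB minB] [CB ctB]] := hB.
have [ee _ _] := he; have [epseps _ _] := heps.
have eE := simple_eA hfe ee (simple_iso hPe hPs).
have epsE := simple_DAe hge epseps (simple_iso hIeps hIs).
(* From here on [e] and [eps] are replaced by the members [EA i0] and [EB j0]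
   of the complete systems that lie at the same vertices. *)
have [i0 [f_i0 f_other]] := character_vertex f primA orthA sumA.
have [j0 [g_j0 _]] := character_vertex g primB orthB sumB.
have i0E := left_vertex primA hfe eE f_i0.
have j0E := right_vertex primB hge epsE g_j0.
have gdG := gldim_glue f_i0 i0E g_j0 j0E gdA gdB.
have [d gd mind] := least_nat gdG.
exists d; split; last split.
- rewrite geq_max minA ?minB //.
    exact: (gldim_glueB f_i0 i0E gd).
  exact: gldim_glueA f_i0 i0E g_j0 j0E _ gd.
- exact: mind.
- exact: (glue_basic primA orthA sumA isoA primB orthB sumB isoB
    f_i0 f_other i0E g_j0 j0E).
- exact: (glue_directed f_i0 i0E g_j0 j0E).
- by split.
- by eexists; apply: (glue_cluster_tilting f_i0 i0E g_j0 j0E gdA gdB ctA ctB).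
Qed.
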